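(* Let $i\colon A\to X$ be a cofibration of directed graphs and $f\colon A\to Y$ any map of directed graphs. Form the pushout $X\cup_A Y$ in the category of directed graphs, with canonical maps $g\colon X\to X\cup_A Y$ and $j\colon Y\to X\cup_A Y$. Then there is a short exact sequence in magnitude homology $$0\to\mathrm{MH}_{*,*}(A)\xrightarrow{(i_*,-f_* )}\mathrm{MH}_{*,*}(X)\oplus\mathrm{MH}_{*,*}(Y)\xrightarrow{g_*\oplus j_*}\mathrm{MH}_{*,*}(X\cup_A Y)\to 0,$$ and this sequence is split.
   Context: Fix a commutative ground ring $R$. A directed graph $G$ has a vertex set $V(G)$ and edge set $E(G)\subseteq V(G)\times V(G)$ (loops allowed). A map of directed graphs $G\to H$ is a function $f\colon V(G)\to V(H)$ such that for each edge $x\to y$ of $G$ either $f(x)=f(y)$ or $f(x)\to f(y)$ is an edge of $H$. The resulting category is cocomplete. The distance $d(x,y)\in\{0,1,\dots,\infty\}$ is the minimal number of edges in a directed path from $x$ to $y$; the length of a tuple is $\ell(x_0,\dots,x_k)=\sum_i d(x_i,x_{i+1})$. Cofibrations: for a subgraph $A\subseteq X$, the reach $rA$ is the induced subgraph of $X$ on all vertices that admit a directed path from some vertex of $A$. A cofibration is an induced subgraph inclusion $A\hookrightarrow X$ such that (1) there are no edges from vertices not in $A$ to vertices in $A$; and (2) for each $x\in rA$ there is a vertex $\pi(x)\in A$ with $d(a,x)=d(a,\pi(x))+d(\pi(x),x)$ for every $a\in A$. The magnitude chain complex $\mathrm{MC}_{*,\ell}(G)$ has in degree $k$ the free $R$-module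 on tuples $(x_0,\dots,x_k)$ of vertices with consecutive entries distinct and with length exactly $\ell$; its differential is $\sum_i(-1)^i(x_0,\dots,\widehat{x_i},\dots,x_k)$, omitting terms with repeated consecutive entries or of length less than $\ell$. Magnitude homology is $\mathrm{MH}_{k,\ell}(G)=H_k(\mathrm{MC}_{*,\ell}(G))$. A map of graphs acts on generators entrywise, with a tuple sent to zero if its image has repeated consecutive entries or smaller length. The map $g_*\oplus j_*$ sends $(u,v)$ to $g_*(u)+j_*(v)$. *)

(* Defs.v *)
From HB Require Import structures.
From mathcomp Require Import all_boot all_algebra boolp zify.
From mathcomp Require Import freeg.

Set Implicit Arguments.
Unset Strict Implicit.
Unset Printing Implicit Defensive.

Import GRing.Theory.
Local Open Scope ring_scope.
Local Open Scope quotient_scope.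

(* Under the choice axiom of boolp every type is a [choiceType] and every
   relation is boolean, so this is no restriction on the vertices or edges. *)
Record digraph := Digraph { vertex :> choiceType; edge : rel vertex }.

Record digraph_map (G H : digraph) := DigraphMap {
  digraph_fun :> G -> H;
  digraph_funP : forall x y : G,
    edge x y -> digraph_fun x = digraph_fun y \/
                edge (digraph_fun x) (digraph_fun y) }.

Definition isPushout (A X Y P : digraph) (i : digraph_map A X)
    (f : digraph_map A Y) (g : digraph_map X P) (j : digraph_map Y P) : Prop :=
  g \o i =1 j \o f /\
  forall (Z : digraph) (u : digraph_map X Z) (v : digraph_map Y Z),
    u \o i =1 v \o f ->
    (exists w : digraph_map P Z, w \o g =1 u /\ w \o j =1 v) /\
    (forall w w' : digraph_map P Z,
       w \o g =1 u -> w \o j =1 v -> w' \o g =1 u -> w' \o j =1 v -> w =1 w').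

(* Extended naturals: [None] is infinity. *)
Definition oaddn (m n : option nat) : option nat :=
  if m is Some a then if n is Some b then Some (a + b)%N else None else None.

Section Distance.
Variable G : digraph.
Implicit Types (x y : G) (s p : seq G).

Definition dpath x y p : bool := path (@edge G) x p && (last x p == y).

Definition dist x y : option nat :=
  match pselect (exists n, `[< exists2 p, dpath x y p & size p = n >]) with
  | left ex => Some (ex_minn ex)
  | right _ => None
  end.

Definition len s : option nat :=
  if s is x :: p then foldr oaddn (Some 0%N) (pairmap dist x p) else Some 0%N.

(* [sorted] only relates consecutive entries. *)
Definition regular s : bool := sorted (fun x y => x != y) s.

End Distance.

Definition induced_inclusion (A X : digraph) (i : digraph_map A X) : Prop :=
  injective i /\ forall a b : A, edge (i a) (i b) = edge a b.

Definition reach (A X : digraph) (i : digraph_map A X) (x : X) : Prop :=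
  exists (a : A) (p : seq X), dpath (i a) x p.

(* [i] stands for the inclusion of its image.  By the second clause, paths of
   [X] ending in the image stay in it, so distances in [A] and [X] agree. *)
Definition cofibration (A X : digraph) (i : digraph_map A X) : Prop :=
  [/\ induced_inclusion i,
      forall (x : X) (a : A), (forall b : A, i b <> x) -> ~~ edge x (i a)
    & forall x : X, reach i x ->
        exists p : A, forall a : A,
          dist (i a) x = oaddn (dist (i a) (i p)) (dist (i p) x)].

Section Homology.
Variables (R : pzRingType) (L M N : lmodType R).
Variables (d1 : {linear L -> M}) (d2 : {linear M -> N}).

Definition ker_pred : {pred M} := fun c => d2 c == 0.

Fact ker_submod : submod_closed ker_pred.
Proof.
split=> [|a x y]; rewrite !unfold_in; first by rewrite linear0.
by move=> /eqP dx /eqP dy; rewrite linearP dx dy scaler0 addr0.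
Qed.

HB.instance Definition _ := GRing.isSubmodClosed.Build R M ker_pred ker_submod.

Definition cycle := {c : M | c \in ker_pred}.
HB.instance Definition _ := Choice.on cycle.
HB.instance Definition _ := SubChoice.on cycle.
HB.instance Definition _ := [SubChoice_isSubLmodule of cycle by <:].

(* Boundaries are taken among the cycles, so that [homology] makes sense, as
   ker d2 / (ker d2 :&: im d1), without a proof of [d2 \o d1 =1 0]. *)
Definition boundary : {pred cycle} := fun z => `[< exists b, d1 b = val z >].

Fact boundary_submod : submod_closed boundary.
Proof.
split=> [|a x y]; rewrite !unfold_in; first by apply/asboolP; exists 0; rewrite linear0.
move=> /asboolP[b db] /asboolP[c dc]; apply/asboolP; exists (a *: b + c).
by rewrite linearP db dc linearP.
Qed.

HB.instance Definition _ :=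
  GRing.isSubmodClosed.Build R cycle boundary boundary_submod.

Definition homology := {ideal_quot boundary}.
HB.instance Definition _ := ZmodQuotient.on homology.
HB.instance Definition _ := Choice.on homology.

Definition homology_scale (a : R) : homology -> homology :=
  lift_op1 homology ( *:%R a).

Fact pi_homology_scale a : {morph \pi_homology : x / a *: x >-> homology_scale a x}.
Proof.
move=> x; unlock homology_scale; apply/eqP.
rewrite -Quotient.idealrBE -scalerBr rpredZ //.
by rewrite Quotient.idealrBE reprK.
Qed.

Fact homology_scaleA a b x : homology_scale a (homology_scale b x) = homology_scale (a * b) x.
Proof. by rewrite -[x]reprK -!pi_homology_scale scalerA. Qed.

Fact homology_scale1 x : homology_scale 1 x = x.
Proof. by rewrite -[x]reprK -!pi_homology_scale scale1r. Qed.

Fact homology_scaleDr : right_distributive homology_scale +%R.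
Proof.
move=> a x y; rewrite -[x]reprK -[y]reprK.
by rewrite -!pi_addr -!pi_homology_scale -pi_addr scalerDr.
Qed.

Fact homology_scaleDl x : {morph homology_scale^~ x : a b / a + b}.
Proof. by move=> a b; rewrite -[x]reprK -!pi_homology_scale scalerDl pi_addr. Qed.

HB.instance Definition _ := GRing.Zmodule_isLmodule.Build R homology
  homology_scaleA homology_scale1 homology_scaleDr homology_scaleDl.

Fact pi_homology_linear : linear \pi_homology.
Proof. by move=> a x y; rewrite pi_addr pi_homology_scale. Qed.

End Homology.

Section HomologyMap.
Variables (R : pzRingType) (L M N L' M' N' : lmodType R).
Variables (d1 : {linear L -> M}) (d2 : {linear M -> N}).
Variables (d1' : {linear L' -> M'}) (d2' : {linear M' -> N'}).
Variables (fL : {linear L -> L'}) (fM : {linear M -> M'}) (fN : {linear N -> N'}).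
Hypothesis comm1 : forall b, d1' (fL b) = fM (d1 b).
Hypothesis comm2 : forall c, d2' (fM c) = fN (d2 c).

Fact cycle_map_subproof (z : cycle d2) : fM (val z) \in ker_pred d2'.
Proof. by rewrite unfold_in comm2 (eqP (valP z)) linear0. Qed.

Definition cycle_map (z : cycle d2) : cycle d2' :=
  exist _ (fM (val z)) (cycle_map_subproof z).

Definition homology_fun (h : homology d1 d2) : homology d1' d2' :=
  \pi_(homology d1' d2') (cycle_map (repr h)).

Fact homology_fun_pi (z : cycle d2) :
  homology_fun (\pi_(homology d1 d2) z) = \pi_(homology d1' d2') (cycle_map z).
Proof.
apply/eqP; rewrite -Quotient.idealrBE unfold_in.
have := reprK (\pi_(homology d1 d2) z).
move/eqP; rewrite -Quotient.idealrBE unfold_in => /asboolP[b db].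
by apply/asboolP; exists (fL b); rewrite comm1 db !linearB.
Qed.

Fact homology_fun_linear : linear homology_fun.
Proof.
move=> a x y; rewrite -[x]reprK -[y]reprK.
rewrite -pi_homology_linear !homology_fun_pi -pi_homology_linear; congr (\pi _).
by apply: val_inj; rewrite /= linearP.
Qed.

Definition homology_map : {linear homology d1 d2 -> homology d1' d2'} :=
  HB.pack homology_fun
    (GRing.isLinear.Build R _ _ _ homology_fun homology_fun_linear).

End HomologyMap.

Section LinearExtension.
Variables (R : comNzRingType) (K : choiceType) (M : lmodType R) (f : K -> M).

Definition linext (D : {freeg K / R}) : M := fglift f D.

Lemma linextU c x : linext << c *g x >> = c *: f x.
Proof. exact: liftU. Qed.

Fact linext_linear : linear linext.
Proof.
have addl : {morph linext : x y / x + y}.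
  move=> x y; have B := lift_is_additive f.
  have N z : linext (- z) = - linext z.
    have := B 0 z; have := B 0 0; rewrite !sub0r subrr oppr0 /linext => -> ->.
    by rewrite sub0r.
  by have := B x (- y); rewrite opprK -/(linext _) -/(linext _) -/(linext _) N opprK.
have l0 : linext 0 = 0.
  by apply: (addIr (linext 0)); rewrite -addl !add0r.
move=> a x y; rewrite addl; congr (_ + _).
have lsum (r : seq K) (F : K -> {freeg K / R}) :
    linext (\sum_(k <- r) F k) = \sum_(k <- r) linext (F k).
  exact: (big_morph linext addl l0).
rewrite -[in RHS](freeg_sumE x) [_ *: x]/(fgscale a x) /fgscale !lsum scaler_sumr.
by apply: eq_bigr => k _; rewrite !linextU scalerA.
Qed.

HB.instance Definition _ := GRing.isLinear.Build R {freeg K / R} M _ linext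
  linext_linear.

Lemma linextX x : linext << x >> = f x.
Proof. by rewrite linextU scale1r. Qed.

End LinearExtension.

Section MagnitudeComplex.
Variables (R : comNzRingType) (G : digraph).

Definition mc_gen (k l : nat) :=
  {s : seq G | [&& size s == k.+1, regular s & len s == Some l]}.
HB.instance Definition _ k l := Choice.on (mc_gen k l).

Definition MC (k l : nat) := {freeg (mc_gen k l) / R}.
HB.instance Definition _ k l := GRing.Lmodule.on (MC k l).

(* The basis element of [s], or 0 when [s] is not a generator. *)
Definition mc_basis (k l : nat) (s : seq G) : MC k l :=
  if insub s is Some t then << (t : mc_gen k l) >> else 0.

Definition del (T : Type) (i : nat) (s : seq T) := take i s ++ drop i.+1 s.

(* By the triangle inequality a face of a generator of length [l] has length at
   most [l], so the faces that are kept are those that are generators of length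
   [l].  For [k = 0] the only face is the empty sequence, which is never a
   generator: [mc_diff 0] is the zero map, with [MC 0] as a dummy target. *)
Definition mc_diff (k l : nat) : {linear MC k l -> MC k.-1 l} :=
  linext (fun x : mc_gen k l =>
    \sum_(i < k.+1) (-1) ^+ i *: mc_basis k.-1 l (del i (val x))).

(* [mc_diff k.+1 l] has target [MC k.+1.-1 l], which is [MC k l]. *)
Definition MH (k l : nat) :=
  @homology R (MC k.+1 l) (MC k l) (MC k.-1 l) (mc_diff k.+1 l) (mc_diff k l).
HB.instance Definition _ k l := GRing.Lmodule.on (MH k l).

End MagnitudeComplex.

Section DistanceTheory.
Variable G : digraph.
Implicit Types (x y z : G) (s p : seq G).

Definition oleq (m n : option nat) : bool :=
  if n is Some b then if m is Some a then (a <= b)%N else false else true.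

Lemma oleq_trans n m o : oleq m n -> oleq n o -> oleq m o.
Proof. by case: n m o => [b|] [a|] [c|] //=; exact: leq_trans. Qed.

Lemma oleqnn m : oleq m m. Proof. by case: m => /=. Qed.

Lemma oleq_add m m' n n' :
  oleq m m' -> oleq n n' -> oleq (oaddn m n) (oaddn m' n').
Proof. by case: m m' n n' => [?|] [?|] [?|] [?|] //=; exact: leq_add. Qed.

Lemma oleq_addl m n : oleq n (oaddn m n).
Proof. by case: m n => [?|] [?|] //=; exact: leq_addl. Qed.

Lemma oaddnA : associative oaddn.
Proof. by case=> [?|] [?|] [?|] //=; rewrite addnA. Qed.

Lemma dist_le x y p : dpath x y p -> oleq (dist x y) (Some (size p)).
Proof.
move=> xyp; rewrite /dist; case: pselect => [ex|[]] /=.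
  by case: ex_minnP => m _; apply; apply/asboolP; exists p.
by exists (size p); apply/asboolP; exists p.
Qed.

Lemma dist_path x y n : dist x y = Some n ->
  exists2 p, dpath x y p & size p = n.
Proof.
rewrite /dist; case: pselect => [ex|//] /=.
by case: ex_minnP => m /asboolP mP _ [<-].
Qed.

Lemma distxx x : dist x x = Some 0%N.
Proof.
have := @dist_le x x [::]; rewrite /dpath /= eqxx => /(_ isT).
by case: dist => //= n; rewrite leqn0 => /eqP ->.
Qed.

Lemma dist_eq0 x y : dist x y = Some 0%N -> x = y.
Proof.
by move=> /dist_path[[|//]]; rewrite /dpath /= => /eqP.
Qed.

Lemma dist_triangle x y z : oleq (dist x z) (oaddn (dist x y) (dist y z)).
Proof.
case xy: (dist x y) => [m|]; last by case: dist.
case yz: (dist y z) => [n|]; last by case: dist.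
have [p /andP[pp /eqP lp] <-] := dist_path xy.
have [q /andP[pq /eqP lq] <-] := dist_path yz.
rewrite /oaddn -size_cat; apply: dist_le.
by rewrite /dpath cat_path last_cat pp lp pq lq eqxx.
Qed.

Lemma len_cons2 x y p : len [:: x, y & p] = oaddn (dist x y) (len (y :: p)).
Proof. by []. Qed.

Lemma len_del i s : oleq (len (del i s)) (len s).
Proof.
elim: i s => [|i IH] [|x [|y p]] //.
- by rewrite /del take0 drop1 /= oleq_addl.
- rewrite len_cons2; case: i IH => [|i] IH; last first.
    rewrite (_ : del _ _ = x :: y :: del i p) // len_cons2.
    by apply: oleq_add; [exact: oleqnn | exact: IH (y :: p)].
  rewrite /del /= drop0; case: p => [|z p] //=; first by case: dist.
  by rewrite oaddnA; apply: oleq_add; [exact: dist_triangle | exact: oleqnn].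
Qed.

End DistanceTheory.

Section MapTheory.
Variables (G H : digraph) (f : digraph_map G H).

Lemma dist_map x y : oleq (dist (f x) (f y)) (dist x y).
Proof.
case xy: (dist x y) => [n|]; last by case: dist.
have [p + <-] := dist_path xy; elim: p x {xy} => [|z p IH] x.
  by rewrite /dpath /= => /eqP ->; rewrite distxx.
move=> /andP[/andP[xz pz] lz]; have zy := IH z (introT andP (conj pz lz)).
apply: oleq_trans (dist_triangle _ (f z) _) _.
apply: (@oleq_trans (oaddn (Some 1%N) (dist (f z) (f y)))).
  apply: oleq_add; last exact: oleqnn.
  case: (digraph_funP f xz) => [->|e]; first by rewrite distxx.
  by apply: (@dist_le _ _ _ [:: f z]); rewrite /dpath /= e eqxx.
by have := oleq_add (oleqnn (Some 1%N)) zy.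
Qed.

Lemma len_map s : oleq (len (map f s)) (len s).
Proof.
elim: s => [|x [|y p] IH] //.
by rewrite [map _ _]/= !len_cons2; apply: oleq_add; [exact: dist_map|].
Qed.

Lemma map_del i s : map f (del i s) = del i (map f s).
Proof. by rewrite /del map_cat map_take map_drop. Qed.

Lemma regular_map s l :
  regular s -> len s = Some l -> len (map f s) = Some l -> regular (map f s).
Proof.
elim: s l => [|x [|y p] IH] l //; rewrite [map _ _]/= !len_cons2 => /andP[xy r].
have := dist_map x y; have := len_map (y :: p).
case E: (len (y :: p)) => [b|]; case xyE: (dist x y) => [a|] //=.
case E': (foldr _ _ _) => [b'|]; case xyE': (dist (f x) (f y)) => [a'|] //=.
move=> lb la [ab] [ab']; rewrite /regular /=; apply/andP; split.
  apply/eqP => fxy; move: xyE'; rewrite fxy distxx => -[a'0].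
  suff a0 : a = 0%N by move: xy; rewrite (dist_eq0 (etrans xyE (congr1 _ a0))) eqxx.
  by subst a'; move: ab' la lb; rewrite add0n => b'l; lia.
by apply: (IH b) => //; rewrite /= E'; congr Some; lia.
Qed.

Lemma regular_map_inv s : regular (map f s) -> regular s.
Proof.
case: s => //= x p; rewrite /regular /= path_map; apply: sub_path => a b /=.
by apply: contraNneq => ->.
Qed.

End MapTheory.

Section MagnitudeMap.
Variables (R : comNzRingType) (G H : digraph) (f : digraph_map G H).

(* A map never increases the length, so a tuple is kept exactly when its image
   is a generator of length [l]. *)
Definition mc_map (k l : nat) : {linear MC R G k l -> MC R H k l} :=
  linext (fun x : mc_gen G k l => mc_basis R k l (map f (val x))).

Lemma mc_basisN (K : digraph) k l (s : seq K) :
  ~~ [&& size s == k.+1, regular s & len s == Some l] -> mc_basis R k l s = 0.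
Proof. by move=> sN; rewrite /mc_basis insubN. Qed.

Lemma mc_basisT (K : digraph) k l (x : mc_gen K k l) :
  mc_basis R k l (val x) = << x >>.
Proof. by rewrite /mc_basis valK. Qed.

Lemma linext_eq (K : choiceType) (M : lmodType R)
    (u v : {linear {freeg K / R} -> M}) :
  (forall x : K, u << x >> = v << x >>) -> u =1 v.
Proof.
move=> uv D; rewrite -(freeg_sumE D) !raddf_sum /=; apply: eq_bigr => x _.
have -> : << coeff x D *g x >> = coeff x D *: << x >> :> {freeg K / R}.
  by apply/eqP/freeg_eqP => y; rewrite coeffZ !coeffU mul1r.
by rewrite !linearZ /= uv.
Qed.

Lemma mc_map_basis k l (s : seq G) : oleq (len s) (Some l) ->
  mc_map k l (mc_basis R k l s) = mc_basis R k l (map f s).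
Proof.
move=> sl; have [sP|sN] := boolP [&& size s == k.+1, regular s & len s == Some l].
  by rewrite -[s]/(val (exist _ s sP : mc_gen G k l)) mc_basisT; exact: linextX.
rewrite mc_basisN // linear0 mc_basisN //; apply: contra sN.
rewrite size_map => /and3P[-> /regular_map_inv -> /eqP E] /=.
by have := len_map f s; rewrite E; case: len sl => //= n nl ln; apply/eqP; congr Some; lia.
Qed.

Lemma mc_diff_basis k l (s : seq G) : [&& size s == k.+1, regular s & len s == Some l] ->
  mc_diff R G k l (mc_basis R k l s) =
  \sum_(i < k.+1) (-1) ^+ i *: mc_basis R k.-1 l (del i s).
Proof.
move=> sP; rewrite -[s]/(val (exist _ s sP : mc_gen G k l)) mc_basisT.
exact: linextX.
Qed.

End MagnitudeMap.

Section MagnitudeFunctor.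
Variables (R : comNzRingType) (G H : digraph) (f : digraph_map G H).

Lemma mc_map_diff k l (c : MC R G k l) :
  mc_diff R H k l (mc_map R f k l c) = mc_map R f k.-1 l (mc_diff R G k l c).
Proof.
apply: (@linext_eq R _ _ (mc_diff R H k l \o mc_map R f k l)
          (mc_map R f k.-1 l \o mc_diff R G k l)) => x /=.
have /and3P[xk xr /eqP xl] := valP x.
rewrite -mc_basisT mc_map_basis ?xl ?oleqnn // [in RHS]mc_diff_basis; last by rewrite xk xr xl eqxx.
rewrite linear_sum /=.
have -> : \sum_(i < k.+1) mc_map R f k.-1 l
      ((-1) ^+ i *: mc_basis R k.-1 l (del i (val x))) =
    \sum_(i < k.+1) (-1) ^+ i *: mc_basis R k.-1 l (del i (map f (val x))).
  apply: eq_bigr => i _; rewrite linearZ /= mc_map_basis ?map_del //.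
  by have := len_del i (val x); rewrite xl.
have [fl|fl] := eqVneq (len (map f (val x))) (Some l).
  rewrite mc_diff_basis // size_map xk fl eqxx andbT /=.
  exact: regular_map xr xl fl.
rewrite mc_basisN ?linear0; last by rewrite (negbTE fl) !andbF.
rewrite big1 // => i _; rewrite mc_basisN ?scaler0 //.
apply: contra fl => /and3P[_ _ /eqP E].
have := len_del i (map f (val x)); have := len_map f (val x).
by rewrite E xl; case: len => //= n nl ln; apply/eqP; congr Some; lia.
Qed.

Definition MH_map (k l : nat) : {linear MH R G k l -> MH R H k l} :=
  @homology_map R _ _ _ _ _ _ _ _ _ _
    (mc_map R f k.+1 l) (mc_map R f k l) (mc_map R f k.-1 l)
    (@mc_map_diff k.+1 l) (@mc_map_diff k l).

End MagnitudeFunctor.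

Definition short_exact (R : pzRingType) (U V W : lmodType R)
    (u : {linear U -> V}) (v : {linear V -> W}) : Prop :=
  [/\ injective u,
      forall y : V, v y = 0 <-> exists x : U, u x = y
    & forall z : W, exists y : V, v y = z].

Definition split_short_exact (R : pzRingType) (U V W : lmodType R)
    (u : {linear U -> V}) (v : {linear V -> W}) : Prop :=
  short_exact u v /\ exists s : {linear W -> V}, cancel s v.

Section PairMaps.
Variables (R : pzRingType) (U V1 V2 W : lmodType R).

Definition pair_sub (a : {linear U -> V1}) (b : {linear U -> V2}) (x : U) :
  V1 * V2 := (a x, - b x).

Fact pair_sub_linear a b : linear (pair_sub a b).
Proof.
by move=> c x y; congr (_, _); rewrite linearP //= opprD -scalerN.
Qed.

HB.instance Definition _ a b :=
  GRing.isLinear.Build R U (V1 * V2)%type _ (pair_sub a b) (pair_sub_linear a b).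

Definition copair (a : {linear V1 -> W}) (b : {linear V2 -> W})
  (p : V1 * V2) : W := a p.1 + b p.2.

Fact copair_linear a b : linear (copair a b).
Proof.
by move=> c x y; rewrite /copair !linearP /= scalerDr addrACA.
Qed.

HB.instance Definition _ a b :=
  GRing.isLinear.Build R (V1 * V2)%type W _ (copair a b) (copair_linear a b).

End PairMaps.

(* Main.v *)
Require Import Defs.
From mathcomp Require Import all_boot all_algebra.
From HB Require Import structures.
From mathcomp Require Import boolp zify freeg.

(* A tuple of finite length visits the image of [A] in [X] (resp. of [Y] in the
   pushout [P]) first and then leaves it for good, and the differential keeps
   both endpoints of a tuple.  Hence the tuples ending outside that image span a
   direct summand of the magnitude complex, complementary to [MC A] (resp.
   [MC Y]), and it suffices that [g] be a quasi-isomorphism between these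
   summands.  Filter the summand by its subcomplex of "matched" tuples: those
   that start in the image, except the tuples [(pi x_1, x_1, ..., x_k)] with all
   [x_i] outside it.  The matched tuples form an acyclic complex: inserting
   [pi x] in front of the first entry [x] outside the image is a contracting
   homotopy up to terms with more entries in the image.  The quotient by them has
   the remaining ("critical") tuples as a basis, and [g] maps the critical tuples
   of [X] bijectively to those of [P]. *)

Set Implicit Arguments.
Unset Strict Implicit.
Unset Printing Implicit Defensive.

Import GRing.Theory.
Local Open Scope ring_scope.
Local Open Scope quotient_scope.

(** * Chains supported on a set of tuples *)

Definition gen (G : digraph) (k l : nat) (s : seq G) : bool :=
  [&& size s == k.+1, regular s & len s == Some l].

Section Support.
Variables (R : comNzRingType) (G : digraph).
Implicit Types (S T : pred (seq G)) (s : seq G) (k l : nat).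

(** Spans of tuples are handled as predicates on chains. [S] is defined on all sequences, so that
    one predicate serves every degree and length. *)
Definition supp S k l (c : MC R G k l) : Prop :=
  forall x : mc_gen G k l, coeff x c != 0 -> S (val x).

Lemma supp0 S k l : supp S (0 : MC R G k l).
Proof. by move=> x; rewrite coeff0 eqxx. Qed.

Lemma suppD S k l (a b : MC R G k l) : supp S a -> supp S b -> supp S (a + b).
Proof.
move=> Sa Sb x; rewrite coeffD => ab.
by have [a0|/Sa//] := eqVneq (coeff x a) 0; apply: Sb; move: ab; rewrite a0 add0r.
Qed.

Lemma suppZ S k l (r : R) (a : MC R G k l) : supp S a -> supp S (r *: a).
Proof.
move=> Sa x; rewrite coeffZ => ra; apply: Sa; apply: contraNneq ra => ->.
by rewrite mulr0.
Qed.

Lemma suppN S k l (a : MC R G k l) : supp S a -> supp S (- a).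
Proof. by rewrite -scaleN1r; exact: suppZ. Qed.

Lemma suppB S k l (a b : MC R G k l) : supp S a -> supp S b -> supp S (a - b).
Proof. by move=> Sa Sb; apply: suppD => //; apply: suppN. Qed.

Lemma supp_sum S k l (I : Type) (r : seq I) (Q : pred I) (F : I -> MC R G k l) :
  (forall i, Q i -> supp S (F i)) -> supp S (\sum_(i <- r | Q i) F i).
Proof.
by move=> SF; elim/big_ind: _ => //; [exact: supp0 | exact: suppD].
Qed.

Lemma supp_basis S k l s : (gen k l s -> S s) -> supp S (mc_basis R k l s).
Proof.
move=> Ss; rewrite /mc_basis; case: insubP => [t|_]; last exact: supp0.
move=> /Ss Ss' ts x; rewrite coeffU mul1r; case: (eqVneq t x) => [<- _|_]; last by rewrite eqxx.
by rewrite ts.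
Qed.

Lemma supp_imp S T k l (c : MC R G k l) :
  (forall s, gen k l s -> S s -> T s) -> supp S c -> supp T c.
Proof. by move=> ST Sc x /Sc; apply: ST; exact: (valP x). Qed.

Lemma supp_ind S k l (P : MC R G k l -> Prop) :
  P 0 -> (forall a b, P a -> P b -> P (a + b)) ->
  (forall r s, gen k l s -> S s -> P (r *: mc_basis R k l s)) ->
  forall c, supp S c -> P c.
Proof.
move=> P0 PD PZ c Sc; rewrite -(freeg_sumE c) big_seq.
elim/big_ind: _ => // x; rewrite mem_dom => /Sc Sx.
have -> : << coeff x c *g x >> = coeff x c *: << x >> :> {freeg (mc_gen G k l) / R}.
  by apply/eqP/freeg_eqP => y; rewrite coeffZ !coeffU mul1r.
by rewrite -mc_basisT; apply: PZ => //; exact: (valP x).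
Qed.

Lemma supp_split S T k l (c : MC R G k l) : supp S c ->
  exists a b, [/\ c = a + b, supp (predI S T) a & supp (predD S T) b].
Proof.
move: c; apply: supp_ind => [|_ _ [a [b [-> Sa Sb]]] [a' [b' [-> Sa' Sb']]]|r s gs Ss].
- by exists 0, 0; split; rewrite ?addr0 //; exact: supp0.
- by exists (a + a'), (b + b'); rewrite addrACA; split=> //; apply: suppD.
case Ts: (T s).
  exists (r *: mc_basis R k l s), 0; rewrite addr0; split=> //; last exact: supp0.
  by apply: suppZ; apply: supp_basis; rewrite /= Ss.
exists 0, (r *: mc_basis R k l s); rewrite add0r; split=> //; first exact: supp0.
by apply: suppZ; apply: supp_basis; rewrite /= Ss Ts.
Qed.

Lemma supp_disjoint S T k l (c : MC R G k l) :
  (forall s, gen k l s -> S s -> T s -> False) -> supp S c -> supp T c -> c = 0.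
Proof.
move=> ST Sc Tc; apply/eqP/freeg_eqP => x; rewrite coeff0; apply/eqP.
by apply: contraT => xc; case: (ST _ (valP x) (Sc x xc) (Tc x xc)).
Qed.

End Support.

Lemma supp_lin (R : comNzRingType) (G H : digraph) (S : pred (seq G))
    (T : pred (seq H)) k l k' l' (u : {linear MC R G k l -> MC R H k' l'}) :
  (forall s, gen k l s -> S s -> supp T (u (mc_basis R k l s))) ->
  forall c, supp S c -> supp T (u c).
Proof.
move=> ST; apply: supp_ind => [|a b Ta Tb|r s gs Ss].
- by rewrite linear0; exact: supp0.
- by rewrite linearD; exact: suppD.
- by rewrite linearZ; apply: suppZ; exact: ST.
Qed.

Lemma linear_ext (R : comNzRingType) (G : digraph) k l (V : lmodType R)
    (S : pred (seq G)) (u v : {linear MC R G k l -> V}) :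
  (forall s, gen k l s -> S s -> u (mc_basis R k l s) = v (mc_basis R k l s)) ->
  forall c, supp S c -> u c = v c.
Proof.
move=> uv; apply: supp_ind => [|a b ea eb|r s gs Ss].
- by rewrite !linear0.
- by rewrite !linearD ea eb.
- by rewrite !linearZ /= uv.
Qed.

(** Sending each basis element to a chosen preimage under [phi] gives a linear left inverse [v] of
    [u] on the chains supported in [S]. *)
Lemma supp_inj (R : comNzRingType) (G H : digraph) (S : pred (seq G)) k l k' l'
    (u : {linear MC R G k l -> MC R H k' l'}) (phi : seq G -> seq H) :
  (forall s, gen k l s -> S s ->
     gen k' l' (phi s) /\ u (mc_basis R k l s) = mc_basis R k' l' (phi s)) ->
  (forall s t, gen k l s -> S s -> gen k l t -> S t -> phi s = phi t -> s = t) ->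
  forall c, supp S c -> u c = 0 -> c = 0.
Proof.
move=> uphi phi_inj c Sc uc.
pose P (t : mc_gen H k' l') s := [/\ gen k l s, S s & phi s = val t].
pose v : {linear MC R H k' l' -> MC R G k l} := linext (fun t : mc_gen H k' l' =>
  if pselect (exists s, P t s) is left ex then mc_basis R k l (projT1 (cid ex)) else 0).
rewrite -[c]/(idfun c) -(@linear_ext R G k l _ S (v \o u) idfun _ c Sc) /= ?uc ?linear0 //.
move=> s gs Ss /=; have [gphi ->] := uphi s gs Ss.
rewrite -[phi s]/(val (exist _ (phi s) gphi : mc_gen H k' l')) mc_basisT linextX.
case: pselect => [ex|[]]; last by exists s.
by case: cid => t /= [gt St E]; congr mc_basis; exact: phi_inj.
Qed.

(** * Faces of tuples *)

Section Deletion.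
Variable G : digraph.
Implicit Types (x y z : G) (s p q : seq G) (k l : nat).

Lemma oaddn0 : right_id (Some 0%N) oaddn.
Proof. by case=> //= n; rewrite addn0. Qed.

Lemma len_cat p x q : len (p ++ x :: q) = oaddn (len (rcons p x)) (len (x :: q)).
Proof.
elim: p => [|y [|z p] IH]; first by rewrite /=; case: foldr.
  by rewrite [cat _ _]/= [rcons _ _]/= !len_cons2 /= oaddn0.
by rewrite [cat _ _]/= [rcons _ _]/= !len_cons2 -oaddnA; congr oaddn.
Qed.

Lemma regular_cat p x q : regular (p ++ x :: q) = regular (rcons p x) && regular (x :: q).
Proof. by case: p => [|y p] //=; rewrite /regular /= cat_path rcons_path /= andbA. Qed.

Lemma regular_cons2 x y p : regular [:: x, y & p] = (x != y) && regular (y :: p).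
Proof. by []. Qed.

Lemma dist_neq x y n : x != y -> dist x y = Some n -> (0 < n)%N.
Proof. by move=> xy; case: n => // /dist_eq0 E; rewrite E eqxx in xy. Qed.

Lemma del_cat p x q : del (size p) (p ++ x :: q) = p ++ q.
Proof.
by rewrite /del take_size_cat // -cat_rcons drop_size_cat // size_rcons.
Qed.

Lemma del_catl i p q : (i < size p)%N -> del i (p ++ q) = del i p ++ q.
Proof.
move=> ip; rewrite /del take_cat ip drop_cat -catA; congr (_ ++ _).
case: ltnP => // pi; have -> : i.+1 = size p by apply/eqP; rewrite eqn_leq ip.
by rewrite subnn drop0 drop_size.
Qed.

Lemma del_catr i p q : del (size p + i) (p ++ q) = p ++ del i q.
Proof.
rewrite /del -addnS drop_cat take_cat !ltnNge !leq_addr /= !addKn -catA.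
by congr (_ ++ _).
Qed.

(** The distance from [x] to the next entry is positive, so dropping [x] loses length. With
    [gen_belast], only inner faces contribute to the differential. *)
Lemma gen_behead k l x s : gen k l (x :: s) -> ~~ gen k.-1 l s.
Proof.
case: s => [|y s]; first by rewrite /gen.
move=> /and3P[_ /andP[xy _]]; rewrite len_cons2 => /eqP E; apply/negP => /and3P[_ _ /eqP E'].
move: E; rewrite E'; case xyE: (dist x y) => [n|] //= -[].
by have := dist_neq xy xyE; lia.
Qed.

Lemma gen_belast k l s x : gen k l (rcons s x) -> ~~ gen k.-1 l s.
Proof.
case/lastP: s => [|s y]; first by rewrite /gen.
rewrite -cats1 cat_rcons => /and3P[_]; rewrite regular_cat => /andP[_ /andP[yx _]].
rewrite len_cat => /eqP E; apply/negP => /and3P[_ _ /eqP E'].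
move: E; rewrite E' /=; case yxE: (dist y x) => [n|] //= -[].
by have := dist_neq yx yxE; lia.
Qed.

Lemma splitn_nth i s : (i < size s)%N -> exists p x q, s = p ++ x :: q /\ size p = i.
Proof.
move=> is_; case E: (drop i s) => [|x q].
  by move: is_; rewrite -subn_gt0 -size_drop E.
by exists (take i s), x, q; rewrite -E cat_take_drop size_takel // ltnW.
Qed.

Lemma supp_diff (R : comNzRingType) (S T : pred (seq G)) k l :
  (forall p x q, p != [::] -> q != [::] -> gen k l (p ++ x :: q) ->
     S (p ++ x :: q) -> gen k.-1 l (p ++ q) -> T (p ++ q)) ->
  forall c, supp S c -> supp T (mc_diff R G k l c).
Proof.
move=> ST; apply: supp_lin => s gs Ss; rewrite mc_diff_basis //.
apply: supp_sum => i _; apply: suppZ; apply: supp_basis.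
have sk : size s = k.+1 by case/and3P: gs => /eqP.
have [|p [x [q [sE <-]]]] := @splitn_nth i s; first by rewrite sk.
rewrite sE del_cat => gpq; rewrite sE in gs Ss; apply: (ST _ x) => //.
  by apply: contraTneq (gpq) => p0; move: gs; rewrite p0; exact: gen_behead.
by apply: contraTneq (gpq) => q0; move: gs; rewrite q0 cats0 cats1; exact: gen_belast.
Qed.
(** A repetition in the face can only come from consecutive entries [y, x, y]. As no length is lost,
    d(y, x) + d(x, y) = 0, contrary to [y != x]. *)
Lemma regular_del k l p x q :
  gen k l (p ++ x :: q) -> len (p ++ q) = Some l -> regular (p ++ q).
Proof.
move=> /and3P[_ + /eqP]; case/lastP: p => [|p y].
  by rewrite -cat_rcons => /cat_sorted2[].
case: q => [|z q]; first by rewrite cats0 => /cat_sorted2[].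
rewrite !cat_rcons !regular_cat => /andP[-> /and3P[yx _ zq]].
rewrite !len_cat !len_cons2 => E E'; rewrite /regular /=; apply/andP; split=> //; apply: contraTneq yx => yz.
move: E E'; rewrite -yz distxx.
case: (len (rcons _ _)) => [a|//]; case: (len (y :: q)) => [b|//].
case yxE: (dist y x) => [c|//]; case: (dist x y) => [d|//] /= [E] [E'].
have c0 : c = 0%N by lia.
by rewrite negbK (dist_eq0 (etrans yxE (congr1 _ c0))) eqxx.
Qed.

Lemma del_del i j s : (i <= j)%N -> del j (del i s) = del i (del j.+1 s).
Proof.
elim: s i j => [|x s IH] i j ij; first by case: i j ij => [|i] [].
case: i j ij => [|i] [|j] // ij; rewrite /del /= ?drop0 //.
by congr (_ :: _); exact: IH.
Qed.

(** If the face has lost length, it is not a generator, but its own faces are then too short as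
    well, and both sides are 0. *)
Lemma mc_diff_face (R : comNzRingType) k l s i : gen k.+1 l s -> (i < k.+2)%N ->
  mc_diff R G k l (mc_basis R k l (del i s)) =
  \sum_(0 <= j < k.+1) (-1) ^+ j *: mc_basis R k.-1 l (del j (del i s)).
Proof.
move=> gs ik; have /and3P[/eqP sk _ /eqP sl] := gs.
have lu := len_del i s; rewrite sl in lu.
have [lE|lE] := eqVneq (len (del i s)) (Some l).
  rewrite mc_diff_basis ?big_mkord // lE eqxx andbT.
  have [|p [x [q [sE iE]]]] := @splitn_nth i s; first by rewrite sk.
  move: gs sk lE; rewrite sE -iE del_cat => gs sk lE; rewrite (regular_del gs lE) andbT.
  by move: sk; rewrite !size_cat /= addnS => -[->].
rewrite mc_basisN ?linear0; last by rewrite (negbTE lE) !andbF.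
rewrite big1 // => j _; rewrite mc_basisN ?scaler0 //.
apply: contra lE => /and3P[_ _ /eqP E]; have := len_del j (del i s); rewrite E.
by case: len lu => //= n nl ln; apply/eqP; congr Some; lia.
Qed.

(** [a i j] stands for face [j] of face [i]. Passing from [n] to [n.+1] adds the row [i = n.+1] and
    the column [j = n], which cancel term by term. *)
Lemma alternating_double_sum (R : pzRingType) (V : lmodType R) (a : nat -> nat -> V) n :
  (forall i j, (i <= j)%N -> a i j = a j.+1 i) ->
  \sum_(0 <= i < n.+1) \sum_(0 <= j < n) (-1) ^+ (i + j) *: a i j = 0.
Proof.
move=> aE; elim: n => [|n IH]; first by rewrite big1 // => i _; rewrite big_geq.
rewrite big_nat_recr //=.
under eq_bigr do rewrite big_nat_recr //=.
rewrite big_split /= IH add0r -big_split /= big_nat_cond big1 // => i /andP[/andP[_ ik] _].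
rewrite [a i n]aE // addSn exprS mulN1r scaleNr [(n + i)%N]addnC.
by rewrite subrr.
Qed.

Lemma mc_diffK (R : comNzRingType) k l (c : MC R G k.+1 l) :
  mc_diff R G k l (mc_diff R G k.+1 l c) = 0.
Proof.
apply: (@linear_ext R G k.+1 l _ predT (mc_diff R G k l \o mc_diff R G k.+1 l) \0); last by [].
move=> s gs _ /=; rewrite mc_diff_basis // linear_sum /=.
rewrite -[RHS](@alternating_double_sum R _ (fun i j => mc_basis R k.-1 l (del j (del i s))) k.+1); last first.
  by move=> i j ij; rewrite del_del.
rewrite big_mkord; apply: eq_bigr => -[i ik] _ /=; rewrite linearZ /= mc_diff_face // scaler_sumr.
by apply: eq_bigr => j _; rewrite scalerA exprD.
Qed.

(* For a tuple [s] with [m] entries in [Q], [T i] is to be the [i]-th face of the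
   tuple obtained from [s] by an insertion at [m], and [U i] the cone over the
   [i]-th face of [s]. *)
Lemma alternating_cancel (R : comNzRingType) (V : lmodType R) (T U : nat -> V) m n :
  (m < n)%N ->
  (forall i, (i < m)%N -> U i = - ((-1) ^+ m *: T i)) ->
  (forall i, (m < i < n)%N -> U i = (-1) ^+ m *: T i.+1) ->
  (-1) ^+ m *: (\sum_(0 <= i < n.+1) (-1) ^+ i *: T i) +
    \sum_(0 <= i < n) (-1) ^+ i *: U i = T m - T m.+1 + (-1) ^+ m *: U m.
Proof.
move=> mn Ul Ur.
rewrite (big_cat_nat (n := m)) //=; last by lia.
rewrite [X in _ + X = _](big_cat_nat (n := m)) //=; last by lia.
rewrite [X in _ *: (_ + X)]big_ltn; last by lia.
rewrite [X in _ *: (_ + (_ + X))]big_ltn; last by lia.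
rewrite [X in _ + (_ + X) = _]big_ltn // [X in _ *: (_ + (_ + (_ + X)))]big_add1 /=.
have -> : \sum_(0 <= i < m) (-1) ^+ i *: U i = - ((-1) ^+ m *: \sum_(0 <= i < m) (-1) ^+ i *: T i).
  rewrite scaler_sumr -sumrN; apply: eq_big_nat => i /andP[_ im].
  by rewrite Ul // scalerN !scalerA mulrC.
have -> : \sum_(m.+1 <= i < n) (-1) ^+ i *: U i = - ((-1) ^+ m *: \sum_(m.+1 <= i < n) (-1) ^+ i.+1 *: T i.+1).
  rewrite scaler_sumr -sumrN; apply: eq_big_nat => i imn.
  by rewrite Ur // !scalerA exprS mulN1r mulrN scaleNr opprK mulrC.
rewrite !scalerDr !scalerA exprS mulN1r mulrN -expr2 sqrr_sign scale1r scaleN1r.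
set a := (X in X + _); set b := (_ *: U m); set c := (_ *: (\sum_(_ <= i < _) _)).
rewrite addrACA subrr add0r -!addrA; do 2 congr (_ + _).
by rewrite addrCA subrr addr0.
Qed.

(** The two faces deleting one [z] agree and have opposite signs; every other face keeps the
    repetition and is 0. This covers insertions that duplicate the preceding entry. *)
Lemma irregular_face_sum (R : comNzRingType) k k' l p z q :
  size (p ++ z :: z :: q) = k.+1 ->
  \sum_(0 <= i < k.+1) (-1) ^+ i *: mc_basis R k' l (del i (p ++ z :: z :: q)) = 0.
Proof.
rewrite size_cat /= => sk; set T := fun i => mc_basis R k' l (del i (p ++ z :: z :: q)).
have T0 s t : mc_basis R k' l (s ++ z :: z :: t) = 0.
  by rewrite mc_basisN // regular_cat /= eqxx !andbF.
have := @alternating_cancel R _ T (fun=> 0) (size p) k.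
rewrite scaler0 addr0 (@big1 _ _ _ _ (index_iota 0 k)); last by move=> i _; rewrite scaler0.
rewrite addr0 => E; rewrite -[LHS](signrZK (size p)) E; first last.
- move=> i /andP[pi ik]; rewrite /T (_ : i.+1 = size p + (i - size p).+1)%N; last by lia.
  rewrite del_catr; case: (i - size p)%N (subn_gt0 (size p) i) => [|j _]; first by rewrite pi.
  by rewrite [del _ _]/= T0 // scaler0.
- by move=> i ip; rewrite /T del_catl // T0 // scaler0 oppr0.
- by lia.
by rewrite /T del_cat -[in X in _ - X]cat_rcons -(size_rcons p z) del_cat cat_rcons subrr scaler0.
Qed.
End Deletion.

(** * Acyclicity of the matched tuples *)

Section Retraction.
Variables (R : comNzRingType) (G : digraph) (Q : pred G) (pr : G -> G).
(* [Q] stands for the image of [A] in [X], or of [Y] in the pushout, and [pr] for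
   the projection to it; [pr x] is only meaningful if [x] is at finite distance
   from [Q]. *)
Hypothesis distNQ : forall x y, ~~ Q x -> Q y -> dist x y = None.
Hypothesis dist_pr : forall y x, Q y -> ~~ Q x ->
  dist y x = oaddn (dist y (pr x)) (dist (pr x) x).
Hypothesis Q_pr : forall y x, Q y -> ~~ Q x -> dist y x <> None -> Q (pr x).
Implicit Types (x y z : G) (s p q ys xs : seq G) (k l m : nat).

Definition upper s : bool := if s is x :: p then ~~ Q (last x p) else false.

(* Generators only: once such a tuple is outside [Q], it stays there. *)
Definition critical s : bool :=
  match s with
  | [::] => false
  | [:: y] => ~~ Q y
  | [:: y, x & _] => ~~ Q y || ~~ Q x && (y == pr x)
  end.

Definition matched s : bool := upper s && ~~ critical s.

Lemma upper_cat p x q : upper (p ++ x :: q) = upper (x :: q).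
Proof. by case: p => //= y p; rewrite last_cat. Qed.

Lemma upper_del p x q : q != [::] -> upper (p ++ x :: q) = upper (p ++ q).
Proof. by case: q => // z q _; rewrite -cat_rcons !upper_cat. Qed.

Lemma supp_upper_diff k l (c : MC R G k l) :
  supp upper c -> supp upper (mc_diff R G k l c).
Proof. by apply: supp_diff => p x q _ q0 _; rewrite upper_del. Qed.

(** A step from outside [Q] into [Q] has infinite distance, so in a tuple of finite length the
    entries in [Q] come first. *)
Lemma len_split s l : len s = Some l ->
  exists ys xs, [/\ s = ys ++ xs, all Q ys & all (predC Q) xs].
Proof.
elim: s l => [|x s IH] l; first by exists [::], [::].
case: s IH => [_ _|y s IH].
  by case Qx: (Q x); [exists [:: x], [::] | exists [::], [:: x]]; rewrite /= Qx.
rewrite len_cons2; case xy: (dist x y) => [n|//].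
case E: (len _) => [m|//] _; have [ys [xs [sE Qys Qxs]]] := IH _ E.
case Qx: (Q x); first by exists (x :: ys), xs; rewrite sE /= Qx.
exists [::], (x :: y :: s); split=> //=; rewrite Qx /=.
case: ys Qys sE Qxs => [_ /= <- //|z ys /= /andP[Qz _] [yz _] _].
by rewrite yz distNQ ?Qx in xy.
Qed.

Lemma upper_split k l s : gen k l s -> upper s ->
  exists ys x xs, [/\ s = ys ++ x :: xs, all Q ys, ~~ Q x & all (predC Q) xs].
Proof.
move=> /and3P[_ _ /eqP /len_split[ys [xs [-> Qys Qxs]]]].
case: xs Qxs => [_|x xs /= /andP[Qx Qxs]]; last by exists ys, x, xs.
rewrite cats0; case/lastP: ys Qys => // ys y; rewrite all_rcons => /andP[Qy _].
by rewrite -cats1 upper_cat /= Qy.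
Qed.

(** Being critical depends on the first two entries only, so the one dangerous face deletes the
    second entry [x] of [y, x, z] when [y = pr z]. The projection property then forces [y = x] or
    [y = pr x], and neither is possible in a matched generator. *)
Lemma supp_matched_diff k l (c : MC R G k l) :
  supp matched c -> supp matched (mc_diff R G k l c).
Proof.
apply: supp_diff => p x q p0 q0 gs /andP[Us Ns] gd.
rewrite /matched -(upper_del _ x) // Us /=.
case: p p0 {Us} gs Ns gd => [//|y [|z p]] _; last by [].
case: q q0 => // z q _; rewrite ![cat _ _]/= => gs Ns gd.
apply/negP => /=; case Qy: (Q y) => /=; last by move: Ns; rewrite /= Qy.
case Qz: (Q z) => //= /eqP yz.
have xy : x != y by case/and3P: gs => _ /andP[]; rewrite eq_sym.
(* The face keeps the length, so [x] lies on a shortest path from [y] to [z]. *)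
have xyz : dist y z = oaddn (dist y x) (dist x z) /\ dist y z <> None.
  case/and3P: gs gd => _ _ /eqP E /and3P[_ _ /eqP].
  move: E; rewrite !len_cons2; case: (len _) => [n|]; last by case: dist => // ?; case: dist.
  case: (dist y z) (dist y x) (dist x z) => [a|] [b|] [c'|] //= [E] [E'].
  by split=> //; congr Some; lia.
case: xyz => E fin.
have yzf := fin; case yzE: (dist y z) yzf => [a|//] _.
have := E; rewrite yzE; case yxE: (dist y x) => [b|//]; case xzE: (dist x z) => [c'|//] [abc].
(* For [x] in [Q], the distance from [x] to [z] is additive through [pr z = y], which gives d(y, x)
   = 0. *)
case Qx: (Q x).
  have := dist_pr Qx (negbT Qz); rewrite -yz xzE yzE; case: dist => // d [].
  by have := dist_neq _ yxE; rewrite eq_sym => /(_ xy); lia.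
(* For [x] outside [Q], a shortest path from [y] to [z] passes through [pr x] and then [x], while
   distances from [pr x] to [z] are additive through [y]. Hence d(y, pr x) = 0. *)
have Qpx : Q (pr x) by apply: (Q_pr Qy); rewrite ?Qx ?yxE.
have ypx : y != pr x by move: Ns; rewrite /= Qy Qx.
have := dist_pr Qy (negbT Qx); rewrite yxE.
case E1: (dist y (pr x)) => [d|//]; case E2: (dist (pr x) x) => [e|//] [bde].
have := dist_pr Qpx (negbT Qz); rewrite -yz yzE.
have := dist_triangle (pr x) x z; rewrite E2 xzE.
case: (dist (pr x) z) => [u|//]; case: (dist (pr x) y) => [v|//] /= ? [?].
by have := dist_neq ypx E1; lia.
Qed.
Definition insert_pr s : seq G :=
  let m := find (predC Q) s in
  take m s ++ (if drop m s is x :: xs then [:: pr x, x & xs] else [::]).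

Lemma find_upper ys x xs : all Q ys -> ~~ Q x -> find (predC Q) (ys ++ x :: xs) = size ys.
Proof.
move=> Qys Qx; rewrite find_cat (negbTE (_ : ~~ has _ _)) /= ?Qx ?addn0 //.
by rewrite has_predC negbK.
Qed.

Lemma insert_prE ys x xs : all Q ys -> ~~ Q x ->
  insert_pr (ys ++ x :: xs) = ys ++ [:: pr x, x & xs].
Proof.
by move=> Qys Qx; rewrite /insert_pr find_upper // take_size_cat // drop_size_cat.
Qed.

Lemma len_insert_pr ys x xs : ys != [::] -> all Q ys -> ~~ Q x ->
  len (ys ++ [:: pr x, x & xs]) = len (ys ++ x :: xs).
Proof.
case/lastP: ys => // p z _; rewrite all_rcons => /andP[Qz _] Qx.
rewrite !cat_rcons !(len_cat p); congr oaddn.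
by rewrite !len_cons2 oaddnA -dist_pr.
Qed.

Lemma regular_insert_pr ys x xs : ys != [::] -> all Q ys -> ~~ Q x ->
  regular (ys ++ [:: pr x, x & xs]) -> regular (ys ++ x :: xs).
Proof.
case/lastP: ys => // p z _; rewrite all_rcons => /andP[Qz _] Qx.
rewrite !cat_rcons !(regular_cat p) !regular_cons2 => /and4P[-> _ _ ->].
by rewrite andbT; apply: contraNneq Qx => <-.
Qed.

Lemma Q_pr_len l ys x xs : ys != [::] -> all Q ys -> ~~ Q x ->
  len (ys ++ x :: xs) = Some l -> Q (pr x).
Proof.
case/lastP: ys => // p z _; rewrite all_rcons => /andP[Qz _] Qx.
rewrite !cat_rcons len_cat len_cons2 => E; apply: (Q_pr Qz Qx) => zx.
by move: E; rewrite zx; case: len.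
Qed.

(** The sign is that of the position of the inserted entry, so that the face deleting it again has
    coefficient 1 in the boundary. *)
Definition cone k l : {linear MC R G k l -> MC R G k.+1 l} :=
  linext (fun s : mc_gen G k l =>
    (-1) ^+ find (predC Q) (val s) *: mc_basis R k.+1 l (insert_pr (val s))).

Lemma cone_gen k l s : gen k l s ->
  cone k l (mc_basis R k l s) =
  (-1) ^+ find (predC Q) s *: mc_basis R k.+1 l (insert_pr s).
Proof.
move=> gs; rewrite -[s]/(val (exist _ s gs : mc_gen G k l)) mc_basisT.
exact: linextX.
Qed.

(** If the tuple is not a generator, neither is the tuple after insertion, and both sides are 0.
    This allows the cone to be computed on faces without checking that they are generators. *)
Lemma cone_basis k l ys x xs : ys != [::] -> all Q ys -> ~~ Q x ->
  cone k l (mc_basis R k l (ys ++ x :: xs)) =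
  (-1) ^+ size ys *: mc_basis R k.+1 l (ys ++ [:: pr x, x & xs]).
Proof.
move=> ys0 Qys Qx; have [gs|gs] := boolP (gen k l (ys ++ x :: xs)).
  by rewrite cone_gen // find_upper // insert_prE.
rewrite (mc_basisN R gs) linear0 mc_basisN ?scaler0 //.
apply: contra gs => /and3P[sk reg lE]; apply/and3P; split.
- by move: sk; rewrite !size_cat /= !addnS eqSS.
- exact: regular_insert_pr reg.
- by rewrite -len_insert_pr.
Qed.

(** The tuple [t] fails to be a generator only if the last entry of [ys] equals [pr x]; then both
    sides are 0 by [irregular_face_sum]. *)
Lemma diff_insert_pr k l ys x xs : ys != [::] -> all Q ys -> ~~ Q x ->
  gen k.+1 l (ys ++ x :: xs) ->
  let t := ys ++ [:: pr x, x & xs] in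
  mc_diff R G k.+2 l (mc_basis R k.+2 l t) =
  \sum_(0 <= i < k.+3) (-1) ^+ i *: mc_basis R k.+1 l (del i t).
Proof.
move=> ys0 Qys Qx /and3P[sk reg /eqP sl] t.
have tk : size t == k.+3 by move: sk; rewrite /t !size_cat /= !addnS eqSS.
have tl : len t = Some l by rewrite /t len_insert_pr.
have Qpx := Q_pr_len ys0 Qys Qx sl.
have [gt|gt] := boolP (gen k.+2 l t); first by rewrite mc_diff_basis // big_mkord.
rewrite mc_basisN // linear0.
have : ~~ regular t by apply: contra gt => rt; rewrite /gen tk rt tl eqxx.
move: reg tk; rewrite {tl gt}/t; case/lastP: ys {sk sl} ys0 Qys => // p z _ _.
rewrite !cat_rcons !regular_cat !regular_cons2 => /and3P[-> _ ->] tk.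
rewrite (_ : pr x != x) ?andbT; last by apply: contraNneq Qx => <-.
by rewrite negbK => /eqP zpx; rewrite -zpx in tk *; rewrite irregular_face_sum //; apply/eqP.
Qed.

(* [find (predC Q) s] counts the entries in [Q] of a generator [s]. *)
Definition deep m s : bool := matched s && (m <= find (predC Q) s)%N.

Lemma deep_cat ys z xs : ys != [::] -> all Q ys -> Q z -> xs != [::] ->
  all (predC Q) xs -> deep (size ys).+1 (ys ++ z :: xs).
Proof.
case: xs => // x xs ys0 Qys Qz _ Qxs; have /andP[Qx _] := Qxs; rewrite /deep /matched.
rewrite -cat_rcons find_upper ?all_rcons ?Qz // size_rcons leqnn andbT.
have lQ : ~~ Q (last x xs) := allP Qxs _ (mem_last x xs).
rewrite upper_cat /= lQ /=.
by case: ys ys0 Qys => // y [|z' ys] _ /= => [/andP[-> _]|/and3P[-> -> _]]; rewrite ?Qz.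
Qed.

(** With m entries in [Q], [alternating_cancel] leaves [s] itself and two error terms: [s] with [x]
    replaced by [pr x], and the cone over [s] without [x]. Both have m + 1 entries in [Q]. *)
Lemma cone_homotopy k l s : gen k.+1 l s -> matched s ->
  supp (deep (find (predC Q) s).+1)
    (mc_basis R k.+1 l s -
     (mc_diff R G k.+2 l (cone k.+1 l (mc_basis R k.+1 l s)) +
      cone k l (mc_diff R G k.+1 l (mc_basis R k.+1 l s)))).
Proof.
move=> gs /andP[us ncs].
have [ys [x [xs [sE Qys Qx Qxs]]]] := upper_split gs us.
rewrite sE find_upper //; rewrite {}sE in gs us ncs.
(* A generator with no entry in [Q] would be critical. *)
have ys0 : ys != [::] by apply: contraNneq ncs => -> /=; case: (xs); rewrite Qx.
have /and3P[/eqP sk _ /eqP sl] := gs.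
have Qpx := Q_pr_len ys0 Qys Qx sl.
pose s' := ys ++ x :: xs; pose t := ys ++ [:: pr x, x & xs].
pose T i := mc_basis R k.+1 l (del i t).
pose U i := cone k l (mc_basis R k l (del i s')).
have tl : len t = Some l by rewrite /t len_insert_pr.
have Ts : T (size ys) = mc_basis R k.+1 l s' by rewrite /T del_cat.
have dU : cone k l (mc_diff R G k.+1 l (mc_basis R k.+1 l s')) =
    \sum_(0 <= i < k.+2) (-1) ^+ i *: U i.
  rewrite mc_diff_basis // linear_sum big_mkord; apply: eq_bigr => i _.
  by rewrite linearZ.
have nk : (size ys < k.+2)%N by rewrite -sk size_cat /= addnS ltnS leq_addr.
have Ul i : (i < size ys)%N -> U i = - ((-1) ^+ size ys *: T i).
  move=> iys; rewrite /U /T !del_catl //.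
  (* If [ys] is a single [y], [cone_basis] does not apply to the face. Then [U i] is 0 because an
     outer face loses length, and [T i] is 0 because otherwise [y = pr x] and the tuple is
     critical. *)
  have [d0|d0] := eqVneq (del i ys) [::].
    have ys1 : size ys = 1%N.
      have : size (del i ys) = 0%N by rewrite d0.
      by rewrite /del size_cat size_takel ?size_drop; lia.
    have [y yE] : exists y, ys = [:: y] by case: (ys) ys1 => [|y []] //; exists y.
    have i0 : i = 0%N by lia.
    rewrite d0 !cat0s mc_basisN ?linear0; last by apply: (@gen_behead _ k.+1 l y); rewrite -[_ :: _]/([:: y] ++ _) -yE.
    rewrite mc_basisN ?scaler0 ?oppr0 //; apply: contra ncs => /and3P[_ _ /eqP El].
    move: tl; rewrite /t yE [_ ++ _]/= len_cons2 El.
    have Qy : Q y by move: Qys; rewrite yE /= andbT.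
    rewrite /= Qy Qx /=; case E': (dist y (pr x)) => [n|//] /= -[nl]; apply/eqP.
    by apply: dist_eq0; rewrite E'; congr Some; lia.
  have Qd : all Q (del i ys).
    by move: Qys; rewrite -{1}(cat_take_drop i.+1 ys) (take_nth x) // /del !all_cat all_rcons => /andP[/andP[_ ->]].
  rewrite cone_basis //.
  (* The face has one entry of [Q] less, so its cone carries the opposite sign. *)
  have -> : size ys = (size (del i ys)).+1.
    by rewrite /del size_cat size_takel ?size_drop; lia.
  by rewrite exprS mulN1r scaleNr opprK.
have Ur i : (size ys < i < k.+2)%N -> U i = (-1) ^+ size ys *: T i.+1.
  (* Here the deletion is behind [x]: the prefix is untouched, and the insertion shifts the deleted
     position by one. *)
  move=> /andP[yi _]; have [j ->] : exists j, i = (size ys + j.+1)%N by exists (i - (size ys).+1)%N; lia.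
  rewrite /U /T -addnS !del_catr.
  by rewrite [del _ _]/= [in RHS]/del /= cone_basis.
have := alternating_cancel nk Ul Ur; rewrite Ts => E.
rewrite cone_basis // linearZ /= diff_insert_pr // dU E.
rewrite opprD addrA opprB addrCA -/s' subrr addr0.
apply: suppB.
  have -> : T (size ys).+1 = mc_basis R k.+1 l (ys ++ pr x :: xs).
    by rewrite /T /t -cat_rcons -(size_rcons ys (pr x)) del_cat cat_rcons.
  apply: supp_basis => /and3P[_ _ /eqP El]; apply: deep_cat => //.
  (* If [x] is the last entry, [t] is longer than [rcons ys (pr x)] by the positive distance from
     [pr x] to [x], so that term is no generator. *)
  apply: contra_eqN tl => /eqP xs0; move: El; rewrite /t xs0 cats1 len_cat => ->.
  rewrite /= oaddn0; case E': (dist _ _) => [n|//] /=; apply: contraNneq Qx => -[nl].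
  have n0 : n = 0%N by lia.
  rewrite n0 in E'; have pE := dist_eq0 E'. by rewrite -pE.
apply: suppZ; rewrite /U del_cat.
(* If [x] is the last entry, deleting it loses length. Otherwise the next entry [x'] is the first
   one outside [Q], and the cone inserts [pr x']. *)
case: xs Qxs gs {us ncs sk sl s' t T U tl Ts dU Ul Ur E} => [_ gs|x' xs Qxs gs].
  rewrite cats0 mc_basisN ?linear0; first exact: supp0.
  by move: gs; rewrite cats1 => /gen_belast.
have /andP[Qx' _] := Qxs; rewrite cone_basis //; apply: suppZ.
apply: supp_basis => /and3P[_ _ /eqP]; rewrite len_insert_pr // => /Q_pr_len Qpx'.
by apply: deep_cat => //; apply: Qpx'.
Qed.

Lemma find_deep k l m (s : seq G) : gen k l s -> deep m s -> (m <= k)%N.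
Proof.
move=> gs /andP[/andP[us _] mf].
have [ys [x [xs [sE Qys Qx Qxs]]]] := upper_split gs us.
case/and3P: gs => /eqP + _ _; move: mf; rewrite sE find_upper // size_cat /=; lia.
Qed.

(** The insertion produces at least two entries in [Q], so the result cannot be critical. *)
Lemma supp_cone k l (c : MC R G k l) : supp matched c -> supp matched (cone k l c).
Proof.
apply: supp_lin => s gs /andP[us ncs].
have [ys [x [xs [sE Qys Qx Qxs]]]] := upper_split gs us; rewrite sE in ncs us *.
have ys0 : ys != [::] by apply: contraNneq ncs => -> /=; case: (xs); rewrite Qx.
rewrite cone_basis //; apply: suppZ; apply: supp_basis => /and3P[_ _ /eqP].
rewrite len_insert_pr // => /(Q_pr_len ys0 Qys Qx) Qpx.
by have /andP[] := deep_cat (xs := x :: xs) ys0 Qys Qpx isT (introT andP (conj Qx Qxs)).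
Qed.

(** Subtracting the boundary of its cone from a cycle raises the depth by one. The induction is on
    [n], which bounds the number of such steps until no generator is deep enough. *)
Lemma deep_acyclic k l m n (z : MC R G k.+1 l) : (k.+1 < m + n)%N ->
  supp (deep m) z -> mc_diff R G k.+1 l z = 0 ->
  exists2 b, supp matched b & mc_diff R G k.+2 l b = z.
Proof.
elim: n m z => [|n IH] m z mn sz dz.
  exists 0; first exact: supp0.
  rewrite linear0; symmetry; apply: (supp_disjoint _ sz sz) => s gs ds _.
  by have := find_deep gs ds; lia.
have mz : supp matched z by apply: supp_imp sz => s _ /andP[].
have hz : supp (deep m.+1) (z - mc_diff R G k.+2 l (cone k.+1 l z)).
  (* The added term is 0 on the cycle [z]; it turns the claim into one that is linear in [z] and can
     be checked on generators. *)
  suff : supp (deep m.+1) (z - (mc_diff R G k.+2 l (cone k.+1 l z) +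
      cone k l (mc_diff R G k.+1 l z))) by rewrite dz linear0 addr0.
  move: z sz {dz mz}; apply: supp_ind => [|a b sa sb|r s gs /andP[ms mf]].
  - by rewrite !linear0 addr0 subr0; exact: supp0.
  - rewrite (linearD (cone k.+1 l)) (linearD (mc_diff R G k.+2 l)).
    rewrite (linearD (mc_diff R G k.+1 l)) (linearD (cone k l)).
    by rewrite addrACA opprD addrACA; exact: suppD.
  - rewrite !linearZ /= -scalerDr -scalerBr; apply: suppZ.
    apply: supp_imp (cone_homotopy gs ms) => u _ /andP[mu fu].
    by rewrite /deep mu (leq_trans _ fu).
have [||b mb db] := IH _ _ _ hz; first by lia.
  by rewrite linearB /= dz mc_diffK subrr.
exists (b + cone k.+1 l z); first by apply: suppD => //; exact: supp_cone.
by rewrite linearD /= db subrK.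
Qed.

Lemma matched_acyclic k l (z : MC R G k l) :
  supp matched z -> mc_diff R G k l z = 0 ->
  exists2 b, supp matched b & mc_diff R G k.+1 l b = z.
Proof.
case: k z => [|k] z mz dz.
  exists 0; first exact: supp0.
  rewrite linear0; symmetry; apply: (supp_disjoint _ mz mz) => -[|x []] // gs.
  (* A tuple with a single entry is critical as soon as it is upper. *)
  by rewrite /matched /= andbN.
apply: (@deep_acyclic k l 0 k.+2) => //.
by apply: supp_imp mz => s _; rewrite /deep andbT.
Qed.
End Retraction.

(** * Splitting off the chains of an isometric subgraph *)

Definition in_image (G H : digraph) (e : digraph_map G H) : pred H :=
  fun x => `[< exists a, e a = x >].

Lemma image_map (G H : digraph) (e : digraph_map G H) (s : seq H) :
  all (in_image e) s -> exists t, map e t = s.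
Proof.
elim: s => [_|x s IH /= /andP[/asboolP[a <-] /IH[t <-]]]; first by exists [::].
by exists (a :: t).
Qed.

Section Isometry.
Variables (R : comNzRingType) (A G : digraph) (e : digraph_map A G).
Hypothesis iso_e : forall a b, dist (e a) (e b) = dist a b.
Implicit Types (k l : nat) (s : seq A) (t : seq G).

Lemma isometry_inj : injective e.
Proof. by move=> a b eab; apply: dist_eq0; rewrite -iso_e eab distxx. Qed.

Lemma len_isometry s : len (map e s) = len s.
Proof.
elim: s => [|x [|y s] IH] //; rewrite [map _ _]/= !len_cons2 iso_e; congr oaddn.
exact: IH.
Qed.

Lemma regular_isometry s : regular (map e s) = regular s.
Proof.
case: s => //= x s; rewrite /regular /= path_map; apply: eq_path => a b /=.
by rewrite (inj_eq isometry_inj).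
Qed.

Lemma gen_isometry k l s : gen k l (map e s) = gen k l s.
Proof. by rewrite /gen size_map regular_isometry len_isometry. Qed.

Lemma mc_map_gen k l s : gen k l s ->
  mc_map R e k l (mc_basis R k l s) = mc_basis R k l (map e s).
Proof. by move=> /and3P[_ _ /eqP sl]; rewrite mc_map_basis // sl oleqnn. Qed.

(** The projection onto the tuples lying in the image; the chosen preimage is unique because [e] is
    injective. *)
Definition restr k l : {linear MC R G k l -> MC R A k l} :=
  linext (fun t : mc_gen G k l =>
    if pselect (exists s, map e s = val t) is left ex
    then mc_basis R k l (projT1 (cid ex)) else 0).

Lemma restr_map k l s : gen k l s ->
  restr k l (mc_basis R k l (map e s)) = mc_basis R k l s.
Proof.
rewrite -gen_isometry => gs.
rewrite -[map e s]/(val (exist _ (map e s) gs : mc_gen G k l)) mc_basisT; apply: etrans (linextX _ _) _.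
case: pselect => [ex|[]]; last by exists s.
by case: cid => t /= /(inj_map isometry_inj) ->.
Qed.

Lemma restr_mc_map k l (c : MC R A k l) : restr k l (mc_map R e k l c) = c.
Proof.
apply: (@linear_ext R A k l _ predT (restr k l \o mc_map R e k l) idfun) => // s gs _ /=.
by rewrite mc_map_gen // restr_map.
Qed.

Lemma restr_upper k l (c : MC R G k l) : supp (upper (in_image e)) c -> restr k l c = 0.
Proof.
apply: (@linear_ext R G k l _ _ (restr k l) \0) => t gt ut /=.
rewrite -[t]/(val (exist _ t gt : mc_gen G k l)) mc_basisT; apply: etrans (linextX _ _) _.
case: pselect => [ex|//]; exfalso; case: ex => s sE.
move: ut; rewrite -[t]sE; case: s {sE} => //= a s.
by rewrite last_map => /asboolP[]; exists (last a s).
Qed.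

Hypothesis dist_image : forall x a, ~~ in_image e x -> dist x (e a) = None.

Lemma dist_Nimage x y : ~~ in_image e x -> in_image e y -> dist x y = None.
Proof. by move=> ix /asboolP[a <-]; exact: dist_image. Qed.

(** A generator ending in the image lies in it entirely, by [len_split], and is restored by
    [mc_map e] after [restr]. All other generators are upper, and [restr] kills them. *)
Lemma supp_restr k l (c : MC R G k l) :
  supp (upper (in_image e)) (c - mc_map R e k l (restr k l c)).
Proof.
have : supp predT c by [].
move: c; apply: supp_ind => [|a b sa sb|r t gt _].
- by rewrite !linear0 addr0; exact: supp0.
- rewrite (linearD (restr k l)) (linearD (mc_map R e k l)) opprD addrACA.
  exact: suppD.
rewrite !linearZ /= -scalerDr; apply: suppZ.
have [ut|ut] := boolP (upper (in_image e) t).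
  rewrite restr_upper ?linear0 ?oppr0 ?addr0; first exact: supp_basis.
  exact: supp_basis.
have /and3P[/eqP tk _ /eqP tl] := gt.
have [ys [xs [tE Qys Qxs]]] := len_split dist_Nimage tl.
case/lastP: xs Qxs tE => [_|xs x].
  rewrite cats0 => tE; have [s sE] := image_map Qys.
  rewrite tE -sE gen_isometry in gt *; rewrite restr_map // mc_map_gen // subrr.
  exact: supp0.
rewrite all_rcons => /andP[Qx _] tE; move: ut; rewrite tE -cats1 catA upper_cat /=.
by move: Qx => /= ->.
Qed.

(** The part of [c] not coming from the image is upper, the differential keeps it upper, and [restr]
    vanishes on it. On the rest, [mc_map e] is a chain map with left inverse [restr]. *)
Lemma restr_diff k l (c : MC R G k l) :
  mc_diff R A k l (restr k l c) = restr k.-1 l (mc_diff R G k l c).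
Proof.
rewrite -[in RHS](subrK (mc_map R e k l (restr k l c)) c).
rewrite (linearD (mc_diff R G k l)) (linearD (restr k.-1 l)).
rewrite [X in _ = X + _]restr_upper ?add0r; last first.
  by apply: supp_upper_diff; exact: supp_restr.
by rewrite mc_map_diff restr_mc_map.
Qed.

End Isometry.

Lemma mc_diff0 (R : comNzRingType) (G : digraph) l (c : MC R G 0 l) :
  mc_diff R G 0 l c = 0.
Proof.
apply: (@linear_ext R G 0 l _ predT (mc_diff R G 0 l) \0) => // s gs _.
rewrite mc_diff_basis // big_ord1 mc_basisN ?scaler0 //.
by case: s gs => [|x []].
Qed.

(** * Comparison of critical tuples *)

Section Excision.
Variables (R : comNzRingType) (X P : digraph) (g : digraph_map X P).
Variables (Q : pred X) (Q' : pred P) (pr : X -> X) (pr' : P -> P).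
Hypothesis distNQ : forall x y, ~~ Q x -> Q y -> dist x y = None.
Hypothesis dist_pr : forall y x, Q y -> ~~ Q x ->
  dist y x = oaddn (dist y (pr x)) (dist (pr x) x).
Hypothesis Q_pr : forall y x, Q y -> ~~ Q x -> dist y x <> None -> Q (pr x).
Hypothesis distNQ' : forall x y, ~~ Q' x -> Q' y -> dist x y = None.
Hypothesis dist_pr' : forall y x, Q' y -> ~~ Q' x ->
  dist y x = oaddn (dist y (pr' x)) (dist (pr' x) x).
Hypothesis Q_pr' : forall y x, Q' y -> ~~ Q' x -> dist y x <> None -> Q' (pr' x).
Hypothesis Q_map : forall x, Q' (g x) = Q x.
Hypothesis map_inj : forall x y, ~~ Q x -> ~~ Q y -> g x = g y -> x = y.
Hypothesis map_surj : forall z, ~~ Q' z -> exists x, g x = z.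
Hypothesis dist_map_NQ : forall x y, ~~ Q x -> ~~ Q y -> dist (g x) (g y) = dist x y.
Hypothesis pr_map : forall x, ~~ Q x -> pr' (g x) = g (pr x).
Hypothesis dist_map_pr : forall x, ~~ Q x -> dist (g (pr x)) (g x) = dist (pr x) x.

Lemma critical_split (G : digraph) (S : pred G) (p : G -> G) k l s :
  (forall x y, ~~ S x -> S y -> dist x y = None) -> gen k l s -> critical S p s ->
  exists x xs, [/\ ~~ S x, all (predC S) xs &
    s = x :: xs \/ S (p x) /\ s = [:: p x, x & xs]].
Proof.
move=> dS /and3P[_ _ /eqP /(len_split dS)[ys [xs [-> Sys Sxs]]]].
case: ys Sys => [|y [|y' ys]] /=.
- case: xs Sxs => // x xs /= /andP[Sx Sxs] _; exists x, xs; split=> //; by left.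
- case: xs Sxs => [|x xs] /=; first by move=> _ /andP[->].
  move=> /andP[Sx Sxs] /andP[Sy _]; rewrite Sy Sx /= => /eqP yp.
  by exists x, xs; split=> //; right; rewrite -yp.
- by move=> /and3P[-> -> _].
Qed.

Lemma all_NQ_map s : all (predC Q') (map g s) = all (predC Q) s.
Proof. by rewrite all_map; apply: eq_all => x /=; rewrite Q_map. Qed.

Lemma len_map_NQ s : all (predC Q) s -> len (map g s) = len s.
Proof.
elim: s => [|x [|y s] IH] // /and3P[Qx Qy Qs]; rewrite [map _ _]/= !len_cons2.
rewrite dist_map_NQ //; congr oaddn; apply: IH; exact/andP.
Qed.

Lemma gen_map_len k l s : gen k l s -> len (map g s) = len s -> gen k l (map g s).
Proof.
move=> /and3P[sk sr /eqP sl] E; rewrite /gen size_map sk E sl eqxx andbT /=.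
by apply: (regular_map sr sl); rewrite E.
Qed.

Lemma upper_map s : upper Q' (map g s) = upper Q s.
Proof. by case: s => //= x s; rewrite last_map Q_map. Qed.

Lemma map_NQ_inj s t : all (predC Q) s -> all (predC Q) t -> map g s = map g t -> s = t.
Proof.
elim: s t => [|x s IH] [|y t] //= /andP[Qx Qs] /andP[Qy Qt] [xy st].
by rewrite (map_inj Qx Qy xy) (IH t).
Qed.

Lemma map_NQ_surj t : all (predC Q') t -> exists s, map g s = t.
Proof.
elim: t => [_|z t IH /= /andP[/map_surj[x <-] /IH[s <-]]]; first by exists [::].
by exists (x :: s).
Qed.

(** The length of a critical tuple involves only distances outside [Q] and possibly one from [pr x]
    to [x], and [g] preserves both. *)
Lemma gen_map_critical k l s : gen k l s -> critical Q pr s ->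
  gen k l (map g s) /\ critical Q' pr' (map g s).
Proof.
move=> gs cs; have [x [xs [Qx Qxs sE]]] := critical_split distNQ gs cs.
have Qs : all (predC Q) (x :: xs) by apply/andP.
case: sE => [|[Qp]] sE; rewrite sE in gs *.
  split; first by apply: gen_map_len => //; exact: len_map_NQ.
  by case: xs Qxs {Qs sE gs} => [|y xs] _ /=; rewrite Q_map Qx.
split; last by rewrite /= !Q_map Qp Qx /= pr_map.
apply: gen_map_len => //; rewrite [map _ _]/= !len_cons2 dist_map_pr //.
by congr oaddn; exact: (len_map_NQ Qs).
Qed.

Lemma critical_map_surj k l t : gen k l t -> critical Q' pr' t ->
  exists s, [/\ gen k l s, critical Q pr s & map g s = t].
Proof.
move=> gt ct; have [z [zs [Qz Qzs tE]]] := critical_split distNQ' gt ct.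
have [[|x xs] //= [xz xszs]] := @map_NQ_surj (z :: zs) (introT andP (conj Qz Qzs)).
have Qx : ~~ Q x by rewrite -Q_map xz.
have Qxs : all (predC Q) xs by rewrite -all_NQ_map xszs.
have Qs : all (predC Q) (x :: xs) by apply/andP.
have sE : map g (x :: xs) = z :: zs by rewrite /= xz xszs.
case: tE => [|[Qp]] tE; rewrite {}tE in gt ct *.
  exists (x :: xs); split=> //.
    have /and3P[sk sr sl] := gt; rewrite -sE size_map in sk sr sl.
    by rewrite /gen sk (regular_map_inv sr) -(len_map_NQ Qs).
  by case: (xs) => [|y ys] /=; rewrite Qx.
exists [:: pr x, x & xs]; split; last by rewrite /= -pr_map // xz xszs.
  have /and3P[sk sr sl] := gt.
  have tE : [:: pr' z, z & zs] = map g [:: pr x, x & xs] by rewrite /= -pr_map // xz xszs.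
  rewrite tE size_map in sk sr sl; rewrite /gen sk (regular_map_inv sr) /=.
  move: sl; rewrite [map _ _]/= !len_cons2 dist_map_pr //.
  by rewrite -[g x :: _]/(map g (x :: xs)) len_map_NQ.
have : Q (pr x) by rewrite -Q_map -pr_map // xz.
by rewrite /= => ->; rewrite Qx eqxx.
Qed.

(** Since [g] need not be injective on [Q], first entries in [Q] are compared by length. The tuple
    [t] is an arbitrary generator, as [supp_map_matched] requires. *)
Lemma critical_map_inj k l s t : gen k l s -> critical Q pr s -> gen k l t ->
  map g s = map g t -> s = t.
Proof.
move=> gs cs gt st; have [x [xs [Qx Qxs sE]]] := critical_split distNQ gs cs.
have Qs : all (predC Q) (x :: xs) by apply/andP.
case: sE => [|[Qp]] sE; rewrite {}sE in gs cs st *.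
  by apply: (map_NQ_inj _ _ st) => //; rewrite -all_NQ_map -st all_NQ_map.
case: t st gt => [|y t] // [py st] gt; have xt : map g (x :: xs) = map g t := st.
have Qt : all (predC Q) t by rewrite -all_NQ_map -xt all_NQ_map.
have tE := map_NQ_inj Qs Qt xt; rewrite -{}tE {t st xt Qt} in gt *.
have Qy : Q y by rewrite -Q_map -py Q_map.
have /and3P[_ _ /eqP] := gs; have /and3P[_ _ /eqP] := gt.
(* The tuples share their tail and length, so d(y, x) = d(pr x, x), and additivity through [pr x]
   gives d(y, pr x) = 0. *)
rewrite !len_cons2 (dist_pr Qy Qx).
case: (len _) => [a|]; last by case: (oaddn (dist _ _) (dist _ _)).
case: (dist (pr x) x) => [b|] //=.
case E: (dist y (pr x)) => [d|] //= [ab] [ab'].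
by congr (_ :: _); apply/esym/dist_eq0; rewrite E; congr Some; lia.
Qed.

Lemma supp_mc_map (S : pred (seq X)) (T : pred (seq P)) k l (c : MC R X k l) :
  (forall s, gen k l s -> S s -> gen k l (map g s) -> T (map g s)) ->
  supp S c -> supp T (mc_map R g k l c).
Proof.
move=> ST; apply: supp_lin => s gs Ss; have /and3P[_ _ /eqP sl] := gs.
by rewrite mc_map_basis ?sl ?oleqnn //; apply: supp_basis; exact: ST.
Qed.

Lemma supp_map_critical k l (c : MC R X k l) :
  supp (critical Q pr) c -> supp (critical Q' pr') (mc_map R g k l c).
Proof. by apply: supp_mc_map => s gs cs _; have [] := gen_map_critical gs cs. Qed.

(** If the image of [s] were critical, it would lift to a critical generator, which
    [critical_map_inj] identifies with [s]. *)
Lemma supp_map_matched k l (c : MC R X k l) :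
  supp (matched Q pr) c -> supp (matched Q' pr') (mc_map R g k l c).
Proof.
apply: supp_mc_map => s gs /andP[us cs] gms; rewrite /matched upper_map us /=.
apply: contra cs => /(critical_map_surj gms)[s' [gs' cs' E]].
by rewrite -(critical_map_inj gs' cs' gs E).
Qed.

Lemma map_critical_inj k l (c : MC R X k l) :
  supp (critical Q pr) c -> mc_map R g k l c = 0 -> c = 0.
Proof.
apply: (supp_inj (phi := map g)) => [s gs cs|s t gs cs gt ct]; last first.
  exact: critical_map_inj gs cs gt.
have [gms _] := gen_map_critical gs cs; split=> //; apply: mc_map_basis.
by have /and3P[_ _ /eqP ->] := gs; rewrite oleqnn.
Qed.

Lemma map_critical_surj k l (c : MC R P k l) : supp (critical Q' pr') c ->
  exists2 b, supp (critical Q pr) b & mc_map R g k l b = c.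
Proof.
move: c; apply: supp_ind => [|_ _ [a sa <-] [b sb <-]|r t gt ct].
- by exists 0; [exact: supp0|rewrite linear0].
- by exists (a + b); [exact: suppD|rewrite linearD].
have [s [gs cs sE]] := critical_map_surj gt ct.
exists (r *: mc_basis R k l s); first by apply/suppZ/supp_basis.
rewrite linearZ /= mc_map_basis ?sE //.
by have /and3P[_ _ /eqP ->] := gs; rewrite oleqnn.
Qed.

Lemma critical_upper k l s : gen k l s -> critical Q pr s -> upper Q s.
Proof.
move=> gs cs; have [x [xs [Qx Qxs sE]]] := critical_split distNQ gs cs.
have : predC Q (last x xs) by apply: (allP (_ : all _ (x :: xs))) (mem_last _ _); apply/andP.
by case: sE => [->|[_ ->]].
Qed.

(** The image of the critical part of [c] is critical, and also matched as a difference of matched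
    chains; so it is 0, and [g] is injective on critical chains. *)
Lemma matched_of_map k l (c : MC R X k l) : supp (upper Q) c ->
  supp (matched Q' pr') (mc_map R g k l c) -> supp (matched Q pr) c.
Proof.
move=> uc; have [a [b [-> ca mb]]] := supp_split (critical Q pr) uc => mc.
have {}ca : supp (critical Q pr) a by apply: supp_imp ca => s _ /andP[].
have {}mb : supp (matched Q pr) b by apply: supp_imp mb => s _; rewrite /= /matched andbC.
suff -> : a = 0 by rewrite add0r.
apply: map_critical_inj => //.
apply: (supp_disjoint (T := matched Q' pr') _ (supp_map_critical ca)) => [s gs cs /andP[_ /negP[]]|] //.
suff -> : mc_map R g k l a = mc_map R g k l (a + b) - mc_map R g k l b.
  by apply: suppB => //; exact: supp_map_matched.
by rewrite linearD addrK.
Qed.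

(** Lift the critical part of [z] to [a]. The boundary of [a] is matched, hence equals that of a
    matched [w]. Then [a - w] is a cycle whose image differs from [z] by a matched cycle, which
    bounds. *)
Lemma excision_surj k l (z : MC R P k l) : supp (upper Q') z ->
  mc_diff R P k l z = 0 ->
  exists2 x, mc_diff R X k l x = 0 &
    exists b, mc_diff R P k.+1 l b = mc_map R g k l x - z.
Proof.
move=> uz dz; have [c [n [zE cc mn]]] := supp_split (critical Q' pr') uz.
have {}cc : supp (critical Q' pr') c by apply: supp_imp cc => s _ /andP[].
have {}mn : supp (matched Q' pr') n by apply: supp_imp mn => s _; rewrite /= /matched andbC.
have [a ca acE] := map_critical_surj cc.
have ua : supp (upper Q) a by apply: supp_imp ca => s; exact: critical_upper.
have mda : supp (matched Q pr) (mc_diff R X k l a).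
  apply: matched_of_map; first exact: supp_upper_diff.
  rewrite -mc_map_diff acE.
  have -> : mc_diff R P k l c = - mc_diff R P k l n.
    by apply/eqP; rewrite -addr_eq0 -linearD -zE dz.
  by apply: suppN; exact: supp_matched_diff.
have [w mw dw] : exists2 w, supp (matched Q pr) w & mc_diff R X k l w = mc_diff R X k l a.
  (* In degree 0 the target of the differential is a dummy, so acyclicity cannot be applied; there
     the differential is 0 and [w = 0] will do. *)
  case: k a mda {z uz dz c n zE cc mn ca acE ua} => [|k] a mda.
    by exists 0; [exact: supp0 | rewrite !mc_diff0].
  by apply: matched_acyclic mda _ => //; exact: mc_diffK.
exists (a - w); first by rewrite linearB /= dw subrr.
have mgn : supp (matched Q' pr') (mc_map R g k l (a - w) - z).
  have -> : mc_map R g k l (a - w) - z = - (mc_map R g k l w + n).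
    by rewrite linearB /= acE zE opprD addrACA subrr add0r -opprD.
  by apply/suppN/suppD => //; exact: supp_map_matched.
have [|b _ db] := matched_acyclic distNQ' dist_pr' Q_pr' mgn; last by exists b.
by rewrite linearB /= mc_map_diff linearB /= dw subrr linear0 dz subrr.
Qed.

(** Lift the critical part of [b] to [a]. The image of [x - d a] is the boundary of the matched part
    of [b], so [x - d a] is a matched cycle and bounds. *)
Lemma excision_inj k l (x : MC R X k l) (b : MC R P k.+1 l) :
  supp (upper Q) x -> supp (upper Q') b -> mc_diff R X k l x = 0 ->
  mc_map R g k l x = mc_diff R P k.+1 l b -> exists w, mc_diff R X k.+1 l w = x.
Proof.
move=> ux ub dx gx; have [c [n [bE cc mn]]] := supp_split (critical Q' pr') ub.
have {}cc : supp (critical Q' pr') c by apply: supp_imp cc => s _ /andP[].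
have {}mn : supp (matched Q' pr') n by apply: supp_imp mn => s _; rewrite /= /matched andbC.
have [a ca acE] := map_critical_surj cc.
have ua : supp (upper Q) a by apply: supp_imp ca => s; exact: critical_upper.
have mx : supp (matched Q pr) (x - mc_diff R X k.+1 l a).
  apply: matched_of_map; first by apply: suppB => //; exact: (@supp_upper_diff R X Q k.+1 l a ua).
  have E : mc_map R g k l (mc_diff R X k.+1 l a) = mc_diff R P k.+1 l c.
    by rewrite -acE; exact: esym (mc_map_diff g a).
  rewrite linearB E gx bE linearD addrAC subrr add0r.
  exact: (supp_matched_diff dist_pr' Q_pr' mn).
have [|w _ dw] := matched_acyclic distNQ dist_pr Q_pr mx.
  by rewrite linearB /= dx mc_diffK subrr.
by exists (w + a); rewrite linearD /= dw subrK.
Qed.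
End Excision.

Lemma oleq_anti m n : oleq m n -> oleq n m -> m = n.
Proof. by case: m n => [m|] [n|] //= mn nm; congr Some; apply/eqP; rewrite eqn_leq mn. Qed.

(** * Distances in the pushout *)

Section Cofibration.
Variables (A X : digraph) (i : digraph_map A X).
Hypothesis cof_i : cofibration i.

(** No edge enters the image from outside, so the path, followed backwards from its end, stays in
    the image; its edges come from [A] because the inclusion is induced. *)
Lemma cofibration_path p x b : dpath x (i b) p ->
  exists2 a, i a = x & oleq (dist a b) (Some (size p)).
Proof.
have [[inj_i edge_i] closed_i _] := cof_i.
elim: p x => [|z p IH] x.
  by rewrite /dpath /= => /eqP ->; exists b => //; rewrite distxx.
move=> /andP[/andP[xz pz] lz]; have [|c cz cb] := IH z; first exact/andP.
have [[a ax]|na] := pselect (exists a, i a = x); last first.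
  have /negP[] := closed_i x c (fun a ax => na (ex_intro _ a ax)).
  by rewrite cz.
exists a => //; apply: oleq_trans (dist_triangle a c b) _.
rewrite [size _]/= -[Some _.+1]/(oaddn (Some 1%N) (Some (size p))); apply: oleq_add cb.
by apply: (@dist_le _ _ _ [:: c]); rewrite /dpath /= -edge_i ax cz xz eqxx.
Qed.

Lemma cofibration_isometry a b : dist (i a) (i b) = dist a b.
Proof.
apply: oleq_anti; first exact: dist_map.
case E: (dist (i a) (i b)) => [n|]; last by case: dist.
have [p pE <-] := dist_path E; have [a' aE] := cofibration_path pE.
by have [[inj_i _] _ _] := cof_i; rewrite (inj_i _ _ aE).
Qed.

Lemma cofibration_closed (x : X) (a : A) : ~~ in_image i x -> dist x (i a) = None.
Proof.
case E: (dist x (i a)) => [n|//] /asboolP[]; have [p pE _] := dist_path E.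
by have [b bx _] := cofibration_path pE; exists b.
Qed.

(** [None] marks the vertices outside the reach, which are at infinite distance from the image. *)
Lemma cofibration_proj : exists pi : X -> option A, forall (x : X) (a : A),
  dist (i a) x =
    if pi x is Some p then oaddn (dist (i a) (i p)) (dist (i p) x) else None.
Proof.
suff /boolp.choice[pi piP] : forall x : X, exists q : option A, forall a : A,
    dist (i a) x =
      if q is Some p then oaddn (dist (i a) (i p)) (dist (i p) x) else None.
  by exists pi.
move=> x; have [_ _ proj_i] := cof_i.
have [/proj_i[p pP]|nr] := pselect (reach i x); first by exists (Some p).
exists None => a; case E: dist => [n|//]; have [p pE _] := dist_path E.
by case: nr; exists a, p.
Qed.

End Cofibration.

Section PushoutModel.
Variables (A X Y : digraph) (i : digraph_map A X) (f : digraph_map A Y).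
Hypothesis cof_i : cofibration i.
Variable pi : X -> option A.
Hypothesis piE : forall (x : X) (a : A), dist (i a) x =
  if pi x is Some p then oaddn (dist (i a) (i p)) (dist (i p) x) else None.

Definition glue_edge : rel (Y + X) := fun u v =>
  match u, v with
  | inl y, inl y' => edge y y'
  | inl y, inr x => `[< exists2 a, f a = y & edge (i a) x >]
  | inr x, inr x' => edge x x'
  | inr _, inl _ => false
  end.

(* The vertices [inr x] with [x] in the image of [i] are superfluous; they are
   harmless because [glue_right] avoids them. *)
Definition glue : digraph := Digraph glue_edge.

Definition glue_right_fun (x : X) : glue :=
  if pselect (exists a, i a = x) is left ex then inl (f (projT1 (cid ex))) else inr x.

Lemma glue_right_image a : glue_right_fun (i a) = inl (f a).
Proof.
rewrite /glue_right_fun; case: pselect => [ex|[]]; last by exists a.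
by case: cid => b /= E; have [[inj_i _] _ _] := cof_i; rewrite (inj_i _ _ E).
Qed.

Lemma glue_right_Nimage x : ~~ in_image i x -> glue_right_fun x = inr x.
Proof. by rewrite /glue_right_fun; case: pselect => // ex /asboolP[]. Qed.

Lemma glue_rightP x x' : edge x x' ->
  glue_right_fun x = glue_right_fun x' \/
  edge (glue_right_fun x) (glue_right_fun x').
Proof.
have [[_ edge_i] closed_i _] := cof_i.
have [/asboolP[a <-]|nx] := boolP (in_image i x); have [/asboolP[b <-]|nx'] := boolP (in_image i x').
- rewrite edge_i !glue_right_image => ab.
  by case: (digraph_funP f ab) => [->|e]; [left|right].
- by rewrite glue_right_image (glue_right_Nimage nx') => ax; right; apply/asboolP; exists a.
- have nx_ a : i a <> x by move=> ax; move/asboolP: nx; apply; exists a.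
  by rewrite (negbTE (closed_i x b nx_)).
- by rewrite (glue_right_Nimage nx) (glue_right_Nimage nx') => e; right.
Qed.

Definition glue_right : digraph_map X glue := DigraphMap glue_rightP.

Definition glue_left : digraph_map Y glue :=
  @DigraphMap Y glue (fun y => inl y) (fun x y e => or_intror e).

(* A lower bound for the distance of [glue], and hence, along the map from the
   pushout, for the distance of the pushout. *)
Definition glue_dist (u v : glue) : option nat :=
  match u, v with
  | inl y, inl y' => dist y y'
  | inl y, inr x => if pi x is Some p then oaddn (dist y (f p)) (dist (i p) x) else None
  | inr x, inr x' => dist x x'
  | inr _, inl _ => None
  end.

Lemma dist_edge (G : digraph) (x y z : G) :
  edge x y -> oleq (dist x z) (oaddn (Some 1%N) (dist y z)).
Proof.
move=> xy; apply: oleq_trans (dist_triangle x y z) _; apply: oleq_add (oleqnn _).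
by apply: (@dist_le _ _ _ [:: y]); rewrite /dpath /= xy eqxx.
Qed.

Lemma oleq_none m : oleq m None. Proof. by []. Qed.

(** Decreasing by at most one along each edge is what bounds [glue_dist] by the length of any
    path. *)
Lemma glue_dist_edge u u' v : glue_edge u u' ->
  oleq (glue_dist u v) (oaddn (Some 1%N) (glue_dist u' v)).
Proof.
case: u u' v => [y|x] [y'|x'] [z|z];
  rewrite /glue_edge /glue_dist //; try exact: dist_edge.
  case: (pi z) => [p|] yy'; last exact: oleq_none.
  rewrite oaddnA; apply: oleq_add (oleqnn _).
  exact: dist_edge.
(* The edge comes from one out of [i a]: the distance from [i a] to [z] splits at [i p], and [f]
   does not increase the distance from [a] to [p]. *)
move=> /asboolP[a <- ax]; have := dist_edge z ax; rewrite piE.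
case: (pi z) => [p|//]; apply: oleq_trans; apply: oleq_add (oleqnn _).
by rewrite (cofibration_isometry cof_i); exact: dist_map.
Qed.

Lemma glue_dist_le u v : oleq (glue_dist u v) (dist u v).
Proof.
case E: (dist u v) => [n|]; last exact: oleq_none.
have [p + <-] := dist_path E; elim: p u {E} => [|u' p IH] u.
  rewrite /dpath /= => /eqP <-; case: u => x /=; by rewrite distxx.
move=> /andP[/andP[uu' pu'] lu']; apply: oleq_trans (glue_dist_edge v uu') _.
apply: (oleq_add (oleqnn (Some 1%N))) (IH u' _); exact/andP.
Qed.

End PushoutModel.

Section Pushout.
Variables (A X Y P : digraph).
Variables (i : digraph_map A X) (f : digraph_map A Y).
Variables (g : digraph_map X P) (j : digraph_map Y P).
Hypothesis cof_i : cofibration i.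
Hypothesis pushout_P : isPushout i f g j.
Variable pi : X -> option A.
Hypothesis piE : forall (x : X) (a : A), dist (i a) x =
  if pi x is Some p then oaddn (dist (i a) (i p)) (dist (i p) x) else None.

Let Z := glue i f.
Let gi a : g (i a) = j (f a). Proof. by case: pushout_P => E _; exact: E. Qed.

Lemma pushout_to_glue : exists w : digraph_map P Z,
  w \o g =1 glue_right f cof_i /\ w \o j =1 glue_left i f.
Proof.
case: pushout_P => _ univ; case: (univ Z (glue_right f cof_i) (glue_left i f)) => //.
by move=> a /=; exact: glue_right_image.
Qed.

(** The composite of [w] with the evident map [back] from the model agrees with the identity on [g]
    and [j], so by uniqueness it is the identity of [P], and [back] is onto. *)
Lemma pushout_cover z : (exists y, j y = z) \/ (exists x, g x = z).
Proof.
have [w [wg wj]] := pushout_to_glue.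
pose back (u : Z) : P := match u with inl y => j y | inr x => g x end.
have backP (u v : Z) : edge u v -> back u = back v \/ edge (back u) (back v).
  case: u v => [y|x] [y'|x'] //=; try exact: digraph_funP.
  by move=> /asboolP[a <- ax]; rewrite -gi; exact: digraph_funP.
pose b := DigraphMap backP.
have idP (x y : P) : edge x y -> b (w x) = b (w y) \/ edge (b (w x)) (b (w y)).
  move=> xy; case: (digraph_funP w xy) => [->|e]; first by left.
  exact: digraph_funP e.
pose c := DigraphMap idP.
pose d : digraph_map P P := @DigraphMap P P id (fun x y e => or_intror e).
have E : c =1 d.
  have [_ univ] := pushout_P; have [|_ uniq_w] := univ P g j; first by case: pushout_P.
  apply: uniq_w => // [x|y] /=; last by have /= -> := wj y.
  have /= -> := wg x; have [/asboolP[a <-]|nx] := boolP (in_image i x).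
    by rewrite (glue_right_image f cof_i) /= gi.
  by rewrite glue_right_Nimage.
rewrite -[z]/(d z) -E /=; case: (w z) => [y|x] /=; [left; exists y|right; exists x] => //.
Qed.

(** The upper bound holds because maps do not increase distances, the lower one by mapping to the
    model and using [glue_dist]. The other distances in [P] are found in the same way. *)
Lemma pushout_dist_left y y' : dist (j y) (j y') = dist y y'.
Proof.
have [w [_ wj]] := pushout_to_glue; apply: oleq_anti; first exact: dist_map.
apply: oleq_trans (dist_map w _ _); apply: oleq_trans (glue_dist_le cof_i piE _ _).
by have /= -> := wj y; have /= -> := wj y'; exact: oleqnn.
Qed.

Lemma pushout_dist_back x y : ~~ in_image i x -> dist (g x) (j y) = None.
Proof.
have [w [wg wj]] := pushout_to_glue => nx.
have := oleq_trans (glue_dist_le cof_i piE _ _) (dist_map w (g x) (j y)).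
have /= -> := wg x; have /= -> := wj y; rewrite glue_right_Nimage //=.
by case: dist.
Qed.

Lemma pushout_dist_right x x' : ~~ in_image i x -> ~~ in_image i x' ->
  dist (g x) (g x') = dist x x'.
Proof.
have [w [wg _]] := pushout_to_glue => nx nx'; apply: oleq_anti; first exact: dist_map.
apply: oleq_trans (dist_map w _ _); apply: oleq_trans (glue_dist_le cof_i piE _ _).
have /= -> := wg x; have /= -> := wg x'; rewrite !glue_right_Nimage //.
exact: oleqnn.
Qed.

Lemma pushout_dist_across y x : ~~ in_image i x -> dist (j y) (g x) =
  if pi x is Some p then oaddn (dist y (f p)) (dist (i p) x) else None.
Proof.
have [w [wg wj]] := pushout_to_glue => nx; apply: oleq_anti.
  case: (pi x) => [p|//]; apply: oleq_trans (dist_triangle _ (j (f p)) _) _.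
  by apply: oleq_add; [|rewrite -gi]; exact: dist_map.
apply: oleq_trans (dist_map w _ _); apply: oleq_trans (glue_dist_le cof_i piE _ _).
have /= -> := wj y; have /= -> := wg x; rewrite glue_right_Nimage //.
exact: oleqnn.
Qed.

Lemma pushout_in_image x : in_image j (g x) = in_image i x.
Proof.
have [w [wg wj]] := pushout_to_glue.
have [/asboolP[a <-]|nx] := boolP (in_image i x).
  by apply/asboolP; exists (f a); rewrite gi.
apply/negbTE/asboolP => -[y jy]; have /= := wj y; rewrite jy.
by have /= -> := wg x; rewrite glue_right_Nimage.
Qed.

Lemma pushout_right_inj x x' : ~~ in_image i x -> ~~ in_image i x' ->
  g x = g x' -> x = x'.
Proof. by move=> nx nx' E; apply: dist_eq0; rewrite -pushout_dist_right // E distxx. Qed.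

Lemma pushout_right_surj z : ~~ in_image j z -> exists x, g x = z.
Proof. by case: (pushout_cover z) => // jz /asboolP[]. Qed.

(** The default [x] makes additivity hold outside the reach too: both sides are then infinite. *)
Definition proj x : X := if pi x is Some p then i p else x.

Lemma in_imageP a : in_image i (i a). Proof. by apply/asboolP; exists a. Qed.

Lemma dist_proj y x : in_image i y -> ~~ in_image i x ->
  dist y x = oaddn (dist y (proj x)) (dist (proj x) x).
Proof.
move=> /asboolP[a <-] _; rewrite piE /proj; case E: (pi x) => [p|] //.
by rewrite distxx oaddn0 piE E.
Qed.

Lemma in_image_proj y x : in_image i y -> ~~ in_image i x -> dist y x <> None ->
  in_image i (proj x).
Proof.
move=> /asboolP[a <-] _; rewrite piE /proj; case: (pi x) => // p _; exact: in_imageP.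
Qed.

(** The projection on [P] is transported along [g], which is injective outside the image of [i] and
    covers all of [P] outside the image of [j]. *)
Lemma pushout_proj : exists proj' : P -> P, [/\
  forall x, ~~ in_image i x -> proj' (g x) = g (proj x),
  forall y x, in_image j y -> ~~ in_image j x ->
    dist y x = oaddn (dist y (proj' x)) (dist (proj' x) x) &
  forall y x, in_image j y -> ~~ in_image j x -> dist y x <> None ->
    in_image j (proj' x)].
Proof.
have /boolp.choice[pr' pr'P] : forall z, exists q,
    forall x, ~~ in_image i x -> g x = z -> q = g (proj x).
  move=> z; have [[x nx <-]|nz] := pselect (exists2 x, ~~ in_image i x & g x = z).
    by exists (g (proj x)) => x' nx' E; rewrite (pushout_right_inj nx' nx E).
  by exists z => x nx E; case: nz; exists x.
have pr'E x : ~~ in_image i x -> pr' (g x) = g (proj x) by move=> nx; exact: pr'P.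
exists pr'; split=> // y z /asboolP[y0 <-] nz; have [x xz] := pushout_right_surj nz;
  rewrite -xz pushout_in_image in nz *; rewrite pr'E // pushout_dist_across // /proj.
- case: (pi x) (fun y => pushout_dist_across y nz) => [p|] E.
    by rewrite gi pushout_dist_left E distxx; case: (dist (i p) x).
  by rewrite E.
- by case: (pi x) => // p _; rewrite pushout_in_image; exact: in_imageP.
Qed.

Lemma dist_map_proj x : ~~ in_image i x -> dist (g (proj x)) (g x) = dist (proj x) x.
Proof.
move=> nx; rewrite /proj; case E: (pi x) => [p|]; last by rewrite !distxx.
by rewrite gi pushout_dist_across // E distxx; case: (dist (i p) x).
Qed.
End Pushout.

(** * Homology *)

(** The section corrects any lift by subtracting its retraction to the image of [u]. *)
Lemma split_of_retraction (R : pzRingType) (U V W : lmodType R)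
    (u : {linear U -> V}) (v : {linear V -> W}) (r : {linear V -> U}) :
  cancel u r -> (forall y, v y = 0 <-> exists x, u x = y) ->
  (forall z, exists y, v y = z) -> split_short_exact u v.
Proof.
move=> uK ker_v v_surj; split; first by split=> //; exact: can_inj uK.
pose y z := projT1 (cid (v_surj z)).
have yK z : v (y z) = z by rewrite /y; case: cid.
pose s z := y z - u (r (y z)).
have vu x : v (u x) = 0 by apply/ker_v; exists x.
(* The corrected value is the same for every lift, since two lifts differ by some [u x]; linearity
   of the section follows. *)
have sE t z : v t = z -> s z = t - u (r t).
  move=> vt; have : v (y z - t) = 0 by rewrite linearB yK vt subrr.
  move=> /ker_v[x xE]; have yE : y z = u x + t by rewrite xE subrK.
  by rewrite /s yE (linearD r) uK (linearD u) opprD addrACA subrr add0r.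
have s_lin : linear s.
  move=> a z t; have E : v (a *: y z + y t) = a *: z + t by rewrite linearP !yK.
  by rewrite (sE _ _ E) /s (linearP r) (linearP u) opprD addrACA scalerBr.
pose S : {linear W -> V} := HB.pack s (GRing.isLinear.Build R _ _ _ s s_lin).
exists S => z; rewrite -[S z]/(s z).
by rewrite /s linearB vu subr0.
Qed.

Section Representatives.
Variables (R : pzRingType) (L M N : lmodType R).
Variables (d1 : {linear L -> M}) (d2 : {linear M -> N}).

(** As a relation between cycles and classes, this lets diagram chases run on chains, away from the
    quotient. *)
Definition represents (c : M) (h : homology d1 d2) : Prop :=
  exists2 z : Defs.cycle d2, val z = c & h = \pi_(homology d1 d2) z.

Lemma represents_ex h : exists c, represents c h.
Proof. by exists (val (repr h)), (repr h); rewrite ?reprK. Qed.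

Lemma represents_cycle c h : represents c h -> d2 c = 0.
Proof. by case=> z <- _; exact/eqP/(valP z). Qed.

Lemma cycle_represents c : d2 c = 0 -> exists h, represents c h.
Proof.
move=> dc; have zP : c \in ker_pred d2 by rewrite unfold_in dc.
by exists (\pi_(homology d1 d2) (exist _ c zP)), (exist _ c zP).
Qed.

Lemma represents_eq c h c' h' : represents c h -> represents c' h' ->
  h = h' <-> exists b, d1 b = c - c'.
Proof.
move=> [z <- ->] [z' <- ->]; split.
  by move/eqP; rewrite -Quotient.idealrBE unfold_in => /asboolP[b db]; exists b; rewrite db linearB.
case=> b db; apply/eqP; rewrite -Quotient.idealrBE unfold_in; apply/asboolP.
by exists b; rewrite db linearB.
Qed.

Lemma representsD c h c' h' : represents c h -> represents c' h' ->
  represents (c + c') (h + h').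
Proof. by move=> [z <- ->] [z' <- ->]; exists (z + z'); rewrite ?pi_addr ?linearD. Qed.

Lemma representsN c h : represents c h -> represents (- c) (- h).
Proof. by move=> [z <- ->]; exists (- z); rewrite ?pi_oppr ?linearN. Qed.

Lemma represents0 : represents 0 0.
Proof. by exists 0; rewrite ?linear0 // pi_zeror. Qed.

End Representatives.

Lemma represents_map (R : pzRingType) (L M N L' M' N' : lmodType R)
    (d1 : {linear L -> M}) (d2 : {linear M -> N})
    (d1' : {linear L' -> M'}) (d2' : {linear M' -> N'})
    (fL : {linear L -> L'}) (fM : {linear M -> M'}) (fN : {linear N -> N'})
    (comm1 : forall b, d1' (fL b) = fM (d1 b))
    (comm2 : forall c, d2' (fM c) = fN (d2 c)) c h :
  represents c h -> represents (fM c) (homology_map comm1 comm2 h).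
Proof.
by move=> [z <- ->]; exists (Defs.cycle_map comm2 z) => //=; exact: homology_fun_pi.
Qed.

(** * Assembly of the split exact sequence *)

Section Main.
Variables (R : comNzRingType) (A X Y P : digraph).
Variables (i : digraph_map A X) (f : digraph_map A Y).
Variables (g : digraph_map X P) (j : digraph_map Y P).
Hypothesis cof_i : cofibration i.
Hypothesis pushout_P : isPushout i f g j.
Variables k l : nat.

Lemma represents_MH_map (G H : digraph) (e : digraph_map G H)
    (c : MC R G k l) (h : MH R G k l) :
  represents c h -> represents (mc_map R e k l c) (MH_map R e k l h).
Proof. exact: represents_map. Qed.

Lemma mc_map_square (c : MC R A k l) :
  mc_map R g k l (mc_map R i k l c) = mc_map R j k l (mc_map R f k l c).
Proof.
apply: (@linear_ext R A k l _ predT (mc_map R g k l \o mc_map R i k l)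
  (mc_map R j k l \o mc_map R f k l)) => // s /and3P[_ _ /eqP sl] _ /=.
rewrite !mc_map_basis ?sl ?oleqnn //; try by rewrite -sl; exact: len_map.
rewrite -!map_comp; congr mc_basis; apply: eq_map; case: pushout_P => E _; exact: E.
Qed.

Lemma pushout_isometry y y' : dist (j y) (j y') = dist y y'.
Proof.
have [pi piE] := cofibration_proj cof_i.
exact: (pushout_dist_left cof_i pushout_P piE).
Qed.

Lemma pushout_closed z y : ~~ in_image j z -> dist z (j y) = None.
Proof.
have [pi piE] := cofibration_proj cof_i.
move=> nz; have [x xz] := pushout_right_surj cof_i pushout_P nz.
rewrite -xz (pushout_in_image cof_i pushout_P) in nz *.
exact: (pushout_dist_back cof_i pushout_P piE).
Qed.

Lemma excision :
  let eX := upper (in_image i) in let eP := upper (in_image j) in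
  (forall z : MC R P k l, supp eP z -> mc_diff R P k l z = 0 ->
     exists2 x, mc_diff R X k l x = 0 &
       exists b, mc_diff R P k.+1 l b = mc_map R g k l x - z) /\
  (forall (x : MC R X k l) (b : MC R P k.+1 l), supp eX x -> supp eP b ->
     mc_diff R X k l x = 0 -> mc_map R g k l x = mc_diff R P k.+1 l b ->
     exists w, mc_diff R X k.+1 l w = x).
Proof.
have [pi piE] := cofibration_proj cof_i.
have Q_map x := pushout_in_image cof_i pushout_P x.
have [pr' [pr_map dist_pr' Q_pr']] := pushout_proj cof_i pushout_P piE.
have distNQ x y := dist_Nimage (cofibration_closed cof_i) (x := x) (y := y).
have distNQ' x y := dist_Nimage pushout_closed (x := x) (y := y).
split=> [z uz dz|x b ux ub dx gx].
  apply: (excision_surj distNQ (dist_proj piE) (in_image_proj piE)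
    distNQ' dist_pr' Q_pr' Q_map) => //.
  - exact: (pushout_right_inj cof_i pushout_P piE).
  - exact: (pushout_right_surj cof_i pushout_P).
  - exact: (pushout_dist_right cof_i pushout_P piE).
  - exact: (dist_map_proj cof_i pushout_P piE).
apply: (excision_inj distNQ (dist_proj piE) (in_image_proj piE)
  distNQ' dist_pr' Q_pr' Q_map _ _ _ pr_map _ ux ub dx gx).
- exact: (pushout_right_inj cof_i pushout_P piE).
- exact: (pushout_right_surj cof_i pushout_P).
- exact: (pushout_dist_right cof_i pushout_P piE).
- exact: (dist_map_proj cof_i pushout_P piE).
Qed.

(** The upper part of [c] stays upper under [g] and is killed by [restr]; the remaining part comes
    from [A], where the pushout square commutes. *)
Lemma restr_mc_map_right (c : MC R X k l) :
  restr R j k l (mc_map R g k l c) = mc_map R f k l (restr R i k l c).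
Proof.
rewrite -[c in LHS](subrK (mc_map R i k l (restr R i k l c))).
rewrite (linearD (mc_map R g k l)) (linearD (restr R j k l)) mc_map_square.
rewrite (restr_mc_map pushout_isometry) restr_upper ?add0r //.
apply: (supp_mc_map (S := upper (in_image i))) => [s _ us _|].
  by rewrite (upper_map (pushout_in_image cof_i pushout_P)).
exact: (supp_restr (cofibration_isometry cof_i) (cofibration_closed cof_i)).
Qed.

End Main.

Theorem theorem6p6 (R : comNzRingType) (A X Y P : digraph)
    (i : digraph_map A X) (f : digraph_map A Y)
    (g : digraph_map X P) (j : digraph_map Y P)
    (cof_i : cofibration i) (pushout_P : isPushout i f g j) (k l : nat) :
  split_short_exact
    (pair_sub (MH_map R i k l) (MH_map R f k l))
    (copair (MH_map R g k l) (MH_map R j k l)).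
Proof.
have iso_i := cofibration_isometry cof_i.
have iso_j := pushout_isometry cof_i pushout_P.
have upX := supp_restr iso_i (cofibration_closed cof_i).
have upP := supp_restr iso_j (pushout_closed cof_i pushout_P).
have diffX := restr_diff iso_i (cofibration_closed cof_i).
have diffP := restr_diff iso_j (pushout_closed cof_i pushout_P).
have [ex_surj ex_inj] := excision R cof_i pushout_P k l.
pose rho : {linear MH R X k l -> MH R A k l} :=
  homology_map (diffX R k.+1 l) (diffX R k l).
have rhoP c h : represents c h -> represents (restr R i k l c) (rho h).
  exact: represents_map.
have eqh (G : digraph) (c c' : MC R G k l) (h h' : MH R G k l) b :
    represents c h -> represents c' h' -> mc_diff R G k.+1 l b = c - c' -> h = h'.
  by move=> ch ch' E; apply/(represents_eq ch ch'); exists b.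
(* The retraction ignores the summand of [Y], because restriction already inverts the map induced by
   [i]. *)
pose r : {linear (MH R X k l * MH R Y k l)%type -> MH R A k l} := rho \o fst.
apply: (@split_of_retraction _ _ _ _ _ _ r).
- move=> a; have [c ca] := represents_ex a; rewrite /= /pair_sub /=.
  apply: (eqh _ _ _ _ _ 0 (rhoP _ _ (represents_MH_map i ca)) ca).
  by rewrite linear0 (restr_mc_map iso_i) subrr.
- case=> x y; split=> [E|[a [<- <-]]].
    have [cx hx] := represents_ex x; have [cy hy] := represents_ex y.
    have dx := represents_cycle hx.
    have hxy := representsD (represents_MH_map g hx) (represents_MH_map j hy).
    have [b] := (represents_eq hxy (represents0 _ _)).1 E; rewrite subr0 => db.
    (* Restricting the bounding chain [b] to [Y] shows that [cy] is homologous to minus the image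
       under [f] of the restriction of [cx]. *)
    have sb : mc_diff R Y k.+1 l (restr R j k.+1 l b) =
        mc_map R f k l (restr R i k l cx) + cy.
      rewrite diffP -[_.-1]/k db linearD (restr_mc_map_right cof_i pushout_P).
      by rewrite (restr_mc_map iso_j).
    have hfx := represents_MH_map f (rhoP _ _ hx).
    exists (rho x); congr (_, _); last first.
      symmetry; apply: (eqh _ _ _ _ _ (restr R j k.+1 l b) hy (representsN hfx)).
      by rewrite sb opprK addrC.
    (* The upper part of [cx] maps to the boundary of the upper part of [b], so it bounds in [X] by
       excision. *)
    have [w dw] : exists w, mc_diff R X k.+1 l w =
        cx - mc_map R i k l (restr R i k l cx).
      apply: (ex_inj _ (b - mc_map R j k.+1 l (restr R j k.+1 l b))).
      - exact: upX.
      - exact: upP.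
      - by rewrite linearB mc_map_diff diffX dx !linear0 addr0.
      rewrite !linearB mc_map_diff -[_.-1]/k sb db (mc_map_square pushout_P).
      by rewrite linearD opprD addrACA subrr addr0.
    symmetry; exact: (eqh _ _ _ _ _ _ hx (represents_MH_map i (rhoP _ _ hx)) dw).
  have [c ca] := represents_ex a; rewrite /copair /=.
  have ga := represents_MH_map g (represents_MH_map i ca).
  have ja := represents_MH_map j (representsN (represents_MH_map f ca)).
  apply: (eqh _ _ _ _ _ 0 (representsD ga ja) (represents0 _ _)).
  by rewrite linear0 subr0 linearN (mc_map_square pushout_P) subrr.
- move=> z; have [c cz] := represents_ex z.
  have dc := represents_cycle cz.
  have dsc : mc_diff R Y k l (restr R j k l c) = 0 by rewrite diffP dc linear0.
  (* The restriction of [c] supplies the class from [Y]; excision supplies a cycle of [X] for the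
     remaining upper part. *)
  have [||x dx [b db]] := ex_surj (c - mc_map R j k l (restr R j k l c)).
  - exact: upP.
  - by rewrite linearB mc_map_diff dsc dc linear0 subrr.
  have [hx xP] := cycle_represents (mc_diff R X k.+1 l) dx.
  have [hy yP] := cycle_represents (mc_diff R Y k.+1 l) dsc.
  exists (hx, hy).
  apply: (eqh _ _ _ _ _ b (representsD (represents_MH_map g xP) (represents_MH_map j yP)) cz).
  by rewrite db opprB addrA.
Qed.
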